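(* Let $(G_1,G_2)\sim\mathcal G(n,d,\rho,r)$. For any two graphs $G_1,G_2$ there exists a constant $L=L(G_1,G_2)$ such that for any step size $0<\eta\le L^{-1}$ and any $0<\delta<1$, if $d>32\log\frac{n}{\sqrt\delta}$, then with probability at least $1-\delta$, $$\|\Pi^K-\Pi'\|_F\le\sqrt{\frac{n}{(1-\lambda)(1-r)\,d\,\eta K}}\qquad\text{for any integer }K\ge1,$$ where $\Pi'\in\arg\min_{\Pi\in\mathbb W^n}f(\Pi)$, $\Pi^0\in\mathbb W^n$ is the initial state, and $\Pi^{k+1}=\mathsf{Proj}_{\mathbb W^n}\left(\Pi^k-\eta\nabla f(\Pi^k)\right)$ for $k\ge0$.
   Context: Featured correlated Gaussian Wigner model $\mathcal G(n,d,\rho,r)$, with $n,d\in\mathbb N$ and $\rho,r\in(0,1)$: $G_1,G_2$ are weighted complete graphs, here both with vertex set $[n]=\{1,\dots,n\}$; $\beta_{ij}(G_a)\in\mathbb R$ is the weight of the edge $\{i,j\}$ of $G_a$; vertex $i$ of $G_1$ carries a feature $\bm{x}_i\in\mathbb R^d$ and vertex $j$ of $G_2$ a feature $\bm{y}_j\in\mathbb R^d$. Given a latent permutation $\pi^*$ of $[n]$: the pairs $(\beta_{ij}(G_1),\beta_{\pi^*(i)\pi^*(j)}(G_2))$, $i<j$, are i.i.d. pairs of standard normals with correlation $\rho$; the pairs $(\bm{x}_i,\bm{y}_{\pi^*(i)})$ are i.i.d. $\mathcal N(0,\Sigma_d)$ with $\Sigma_d=\begin{bmatrix} I_d & r I_d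 \\ r I_d & I_d \end{bmatrix}$; features are independent of edge weights. Notation: $\varphi(x)=\frac{x}{1-x^2}$ and $\lambda=\frac{\varphi(\rho)}{\varphi(\rho)+\varphi(r)}\in(0,1)$. $A_1,A_2$ are the symmetric weighted adjacency matrices of $G_1,G_2$ (zero diagonal, off-diagonal entries $\beta_{ij}(G_a)$). For $i\in[d]$, $B_1^i=\mathrm{diag}\{\bm{x}_{1i},\dots,\bm{x}_{ni}\}$ and $B_2^i=\mathrm{diag}\{\bm{y}_{1i},\dots,\bm{y}_{ni}\}$, where $\bm{x}_{ki}$ is the $i$-th coordinate of $\bm{x}_k$ (similarly for $\bm{y}$). For $\Pi\in\mathbb R^{n\times n}$, $$f(\Pi)=\lambda\|A_1\Pi-\Pi A_2\|_F^2+(1-\lambda)\sum_{i=1}^d\|B_1^i\Pi-\Pi B_2^i\|_F^2.$$ $\mathbb W^n$ is the Birkhoff polytope of $n\times n$ doubly stochastic matrices, and $\mathsf{Proj}_{\mathbb W^n}$ is the Euclidean (Frobenius) projection onto it. *)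

(* Defs.v *)
From HB Require Import structures.
From mathcomp Require Import all_boot all_order all_algebra all_fingroup.
From mathcomp Require Import all_classical all_reals all_analysis.

Set Implicit Arguments.
Unset Strict Implicit.
Unset Printing Implicit Defensive.

Import Order.TTheory GRing.Theory Num.Theory.
Import numFieldNormedType.Exports.

Local Open Scope classical_set_scope.
Local Open Scope ring_scope.

(* A weighted complete graph on 'I_n is identified with its weighted adjacency
   matrix; row k of [feat g] is the feature vector carried by vertex k. *)
Record featured_graph (R : realType) (n d : nat) := FeaturedGraph {
  adj : 'M[R]_n;
  adj_sym : adj^T = adj;
  adj_diag : forall i, adj i i = 0;
  feat : 'M[R]_(n, d)
}.

(** Independence *)

Definition mutually_independent d (T : measurableType d) (R : realType)
    (P : probability T R) (I : finType) (F : I -> set (set T)) : Prop :=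
  forall (J : {set I}) (E : I -> set T),
    (forall i, i \in J -> F i (E i)) ->
    P (\bigcap_(i in [set` J]) E i) = (\prod_(i in J) P (E i))%E.

Definition independent2 d (T : measurableType d) (R : realType)
    (P : probability T R) (F G : set (set T)) : Prop :=
  forall A B, F A -> G B -> P (A `&` B) = (P A * P B)%E.

Definition sigma_vec (T : Type) (R : realType) m (X : T -> 'rV[R]_m) :
    set (set T) :=
  g_sigma_preimage (fun k w => X w 0 k).

(** Centered Gaussian vectors *)

(* [normal_prob 0 0] is not the Dirac mass at 0 in the library, whence the
   case distinction. *)
Definition centered_normal (R : realType) (v : R) (A : set R) : \bar R :=
  if v == 0 then \d_(0 : R) A else normal_prob 0 (Num.sqrt v) A.

(* X ~ N(0, S): every linear combination of the coordinates of X, with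
   coefficient vector a, is normal with mean 0 and variance a^T S a. *)
Definition gaussian_vector d (T : measurableType d) (R : realType)
    (P : probability T R) m (S : 'M[R]_m) (X : T -> 'rV[R]_m) : Prop :=
  (forall k, measurable_fun setT (fun w => X w 0 k)) /\
  (forall (a : 'cV[R]_m) (A : set R), measurable A ->
     P ((fun w => (X w *m a) 0 0) @^-1` A) =
     centered_normal ((a^T *m S *m a) 0 0) A).

(* Covariance of two standard Gaussian vectors of R^m with coordinatewise
   correlation c. *)
Definition corr_cov (R : realType) (m : nat) (c : R) : 'M[R]_(m + m) :=
  block_mx 1%:M c%:M c%:M 1%:M.

(** The featured correlated Gaussian Wigner model with latent permutation s *)

Definition edge (n : nat) : finType := {e : 'I_n * 'I_n | (e.1 < e.2)%N}.

Definition edge_pair (T : Type) (R : realType) n d (s : 'S_n)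
    (G1 G2 : T -> featured_graph R n d) (e : edge n) (w : T) : 'rV[R]_(1 + 1) :=
  let i := (val e).1 in let j := (val e).2 in
  row_mx (adj (G1 w) i j)%:M (adj (G2 w) (s i) (s j))%:M.

Definition feature_pair (T : Type) (R : realType) n d (s : 'S_n)
    (G1 G2 : T -> featured_graph R n d) (i : 'I_n) (w : T) : 'rV[R]_(d + d) :=
  row_mx (row i (feat (G1 w))) (row (s i) (feat (G2 w))).

Definition featured_wigner dT (T : measurableType dT) (R : realType)
    (P : probability T R) n d (rho r : R) (s : 'S_n)
    (G1 G2 : T -> featured_graph R n d) : Prop :=
  let Xe := edge_pair s G1 G2 in
  let Xf := feature_pair s G1 G2 in
  [/\ forall e, gaussian_vector P (corr_cov 1 rho) (Xe e),
      mutually_independent P (fun e => sigma_vec (Xe e)),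
      forall i, gaussian_vector P (corr_cov d r) (Xf i),
      mutually_independent P (fun i => sigma_vec (Xf i)) &
      independent2 P <<s \bigcup_e sigma_vec (Xe e) >>
                     <<s \bigcup_i sigma_vec (Xf i) >> ].

(** The objective and projected gradient descent *)

Definition frob (R : realType) m n (A : 'M[R]_(m, n)) : R :=
  Num.sqrt (\sum_i \sum_j A i j ^+ 2).

Definition phi (R : realType) (x : R) : R := x / (1 - x ^+ 2).

Definition lam (R : realType) (rho r : R) : R := phi rho / (phi rho + phi r).

Definition feat_diag (R : realType) n d (g : featured_graph R n d) (i : 'I_d) :
    'M[R]_n :=
  diag_mx (\row_k feat g k i).

Definition objective (R : realType) n d (rho r : R) (g1 g2 : featured_graph R n d)
    (M : 'M[R]_n) : R :=
  lam rho r * frob (adj g1 *m M - M *m adj g2) ^+ 2 +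
  (1 - lam rho r) *
    \sum_(i < d) frob (feat_diag g1 i *m M - M *m feat_diag g2 i) ^+ 2.

Definition birkhoff (R : realType) n : set 'M[R]_n :=
  [set M | [/\ forall i j, 0 <= M i j,
               forall i, \sum_j M i j = 1 &
               forall j, \sum_i M i j = 1]].

Definition argmin (R : realType) (V : Type) (f : V -> R) (C : set V) : set V :=
  [set Z | C Z /\ forall Q, C Q -> f Z <= f Q].

(* The default value 0 of [xget] is irrelevant on nonempty closed convex C,
   where the minimizer exists and is unique. *)
Definition proj (R : realType) m n (C : set 'M[R]_(m, n)) (Y : 'M[R]_(m, n)) :
    'M[R]_(m, n) :=
  xget 0 (argmin (fun Z => frob (Y - Z)) C).

Definition gradient (R : realType) m n (f : 'M[R]_(m, n) -> R)
    (M : 'M[R]_(m, n)) : 'M[R]_(m, n) :=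
  \matrix_(i, j) 'D_(delta_mx i j) f M.

Definition pgd (R : realType) n (f : 'M[R]_n -> R) (eta : R) (M0 : 'M[R]_n)
    (k : nat) : 'M[R]_n :=
  iter k (fun M => proj (birkhoff (n := n)) (M - eta *: gradient f M)) M0.

(* Main.v *)
Require Import Defs.
From HB Require Import structures.
From mathcomp Require Import all_boot all_order all_algebra all_fingroup.
From mathcomp Require Import all_classical all_reals all_analysis.
From mathcomp Require Import measurable_realfun.
From mathcomp Require Import ring lra.

Set Implicit Arguments.
Unset Strict Implicit.
Unset Printing Implicit Defensive.

Import Order.TTheory GRing.Theory Num.Theory.
Import numFieldNormedType.Exports.

Local Open Scope classical_set_scope.
Local Open Scope ring_scope.

(** The randomness enters only through the strong convexity of the objective.

    As a quadratic form in M, the objective dominates its feature part, which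
    equals (1 - lambda) times the sum over k, l of |x_k - y_l|^2 M_kl^2. If all
    n^2 squared distances |x_k - y_l|^2 are at least (1 - r) d, then f has
    quadratic growth with coefficient (1 - lambda) (1 - r) d around its
    minimizer M' on the Birkhoff polytope. The standard analysis of projected
    gradient descent for a smooth convex function gives
    2 eta K (f(M_K) - f(M')) <= |M_0 - M'|^2 ([pgd_value_gap]), and
    |M_0 - M'|^2 <= 2 n since doubly stochastic matrices have squared Frobenius
    norm at most n and nonnegative inner products ([birkhoff_diameter]).
    Combining the two yields the stated rate ([frob_pgd_le]). The smoothness
    constant L bounds both parts of the objective with weight 1, so that it
    depends on the two graphs alone.

    For the probability that all distances are large, x_k - y_l has independent
    N(0, v) coordinates with v = 2 (1 - r) for a matched pair and v = 2
    otherwise. A union bound over n^2 pairs then reduces the claim to the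
    chi-square tail P(|X|^2 <= v d / 2) <= exp(-d/16), which follows from
    E exp(-|X|^2 / (2 v)) = 2^(-d/2) and Markov's inequality, because
    exp(5/16) <= sqrt 2.

    The model describes the law of a Gaussian vector by its one-dimensional
    projections. The exponential moment is computed from these directly,
    without passing to the joint law of the coordinates: writing exp(-x^2/2)
    as the mean of cos(u x) over u ~ N(0, 1) ([integral_cos_normal_prob]) and
    exchanging the integrals replaces one coordinate of X at a time by a
    frequency that is then averaged ([gaussian_laplace_sqnorm]). For an
    unmatched pair the two projections are independent, and
    cos(u - v) = cos u cos v + sin u sin v gives the mean of the cosine of
    their difference ([integral_cos_sub_independent]). *)

(** * Quadratic minimization over the Birkhoff polytope *)

Section FrobeniusInnerProduct.
Context {R : realType} {m n : nat}.
Implicit Types A B C : 'M[R]_(m, n).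

(** The inner product whose norm is the Frobenius norm. *)
Definition ip A B : R := \sum_i \sum_j A i j * B i j.

Lemma ipC A B : ip A B = ip B A.
Proof. by apply: eq_bigr => i _; apply: eq_bigr => j _; rewrite mulrC. Qed.

Lemma ipDr A B C : ip A (B + C) = ip A B + ip A C.
Proof.
rewrite -big_split; apply: eq_bigr => i _ /=; rewrite -big_split.
by apply: eq_bigr => j _; rewrite mxE mulrDr.
Qed.

Lemma ipZr a A B : ip A (a *: B) = a * ip A B.
Proof.
rewrite /ip mulr_sumr; apply: eq_bigr => i _; rewrite mulr_sumr.
by apply: eq_bigr => j _; rewrite mxE mulrCA.
Qed.

Lemma ipDl A B C : ip (A + B) C = ip A C + ip B C.
Proof. by rewrite ipC ipDr !(ipC C). Qed.

Lemma ipZl a A B : ip (a *: A) B = a * ip A B.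
Proof. by rewrite ipC ipZr (ipC B). Qed.

Lemma ipNr A B : ip A (- B) = - ip A B.
Proof. by rewrite -scaleN1r ipZr mulN1r. Qed.

Lemma ipNl A B : ip (- A) B = - ip A B.
Proof. by rewrite ipC ipNr ipC. Qed.

Lemma ip_ge0 A : 0 <= ip A A.
Proof. by apply: sumr_ge0 => i _; apply: sumr_ge0 => j _; rewrite -expr2 sqr_ge0. Qed.

Lemma frob_sqr A : frob A ^+ 2 = ip A A.
Proof.
rewrite sqr_sqrtr; last by do 2 (apply: sumr_ge0 => ? _); rewrite sqr_ge0.
by apply: eq_bigr => i _; apply: eq_bigr => j _; rewrite expr2.
Qed.

Lemma frob_ge0 A : 0 <= frob A.
Proof. exact: sqrtr_ge0. Qed.

End FrobeniusInnerProduct.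

Section ConvexMinimization.
Context {R : realType} {V : lmodType R}.
Variable b : V -> V -> R.
Hypothesis bC : forall X Y, b X Y = b Y X.
Hypothesis bD : forall X Y Z, b X (Y + Z) = b X Y + b X Z.
Hypothesis bZ : forall a X Y, b X (a *: Y) = a * b X Y.

Lemma quad_expand X D : b (X + D) (X + D) = b X X + 2 * b X D + b D D.
Proof. by rewrite bD 2!(bC (X + D)) !bD (bC D X); ring. Qed.

Lemma quadN X : b (- X) (- X) = b X X.
Proof. by rewrite -scaleN1r bZ bC bZ !mulN1r opprK. Qed.

(** If no point of C is nearer to y than M for the form b, then y - M makes an
    obtuse angle with every direction Q - M along which C contains the open
    segment. With y = 0 this is the first-order condition for a minimizer of
    the quadratic form itself; b need not be positive. *)
Lemma quad_argmin_first_order (C : set V) (y M Q : V) :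
  (forall t, 0 < t < 1 -> C (M + t *: (Q - M))) ->
  (forall Z, C Z -> b (y - M) (y - M) <= b (y - Z) (y - Z)) ->
  b (y - M) (Q - M) <= 0.
Proof.
move=> Cc minM; set D := Q - M in Cc *; rewrite leNgt; apply/negP => pos.
have key t : 0 < t < 1 -> 2 * b (y - M) D <= t * b D D.
  move=> t01; have := minM _ (Cc t t01).
  have -> : y - (M + t *: D) = (y - M) + (- t) *: D.
    by rewrite scaleNr opprD addrA.
  rewrite (quad_expand (y - M)) !bZ (bC (_ *: D)) bZ => h.
  have t0 : 0 < t by case/andP: t01.
  rewrite -(ler_pM2l t0).
  move: h; set u := b (y - M) D; set v := b D D; set w := b (y - M) (y - M).
  by move=> h; lra.
have hD : 0 < b D D by have := key (1/2) ltac:(lra); lra.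
(* This t keeps the quadratic term t * b D D below the linear one. *)
pose t := Num.min (1/2) (b (y - M) D / b D D).
have t01 : 0 < t < 1.
  rewrite lt_min gt_min (divr_gt0 pos hD) andbT.
  by apply/andP; split; [lra|apply/orP; left; lra].
have := key t t01.
have : t * b D D <= b (y - M) D by rewrite -ler_pdivlMr// ge_min lexx orbT.
lra.
Qed.

End ConvexMinimization.

Section Birkhoff.
Context {R : realType} {n : nat}.
Implicit Types M Q Y Z : 'M[R]_n.

Lemma birkhoff_segment M Q (t : R) :
  birkhoff M -> birkhoff Q -> 0 < t < 1 -> birkhoff (M + t *: (Q - M)).
Proof.
move=> [M0 Mr Mc] [Q0 Qr Qc] /andP[t0 t1]; split=> [i j|i|j].
- rewrite !mxE; have := M0 i j; have := Q0 i j.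
  move: (M i j) (Q i j) => u v v0 u0.
  have -> : u + t * (v - u) = (1 - t) * u + t * v by ring.
  by rewrite addr_ge0// mulr_ge0//; lra.
- under eq_bigr do rewrite !mxE.
  by rewrite big_split/= -mulr_sumr sumrB Mr Qr subrr mulr0 addr0.
- under eq_bigr do rewrite !mxE.
  by rewrite big_split/= -mulr_sumr sumrB Mc Qc subrr mulr0 addr0.
Qed.

Lemma birkhoff_le1 M i j : birkhoff M -> M i j <= 1.
Proof.
by move=> [M0 Mr Mc]; rewrite -(Mr i) (bigD1 j)//= lerDl sumr_ge0.
Qed.

Lemma birkhoff_ip_le M : birkhoff M -> ip M M <= n%:R.
Proof.
move=> BM; have [M0 Mr _] := BM.
apply: (@le_trans _ _ (\sum_(i < n) (1 : R))); last by rewrite sumr_const card_ord.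
apply: ler_sum => i _; rewrite -(Mr i); apply: ler_sum => j _.
by rewrite ler_piMl// birkhoff_le1.
Qed.

(** Nonnegativity of the entries makes the cross term favourable, whence the
    squared diameter 2n rather than 4n. *)
Lemma birkhoff_diameter M Q : birkhoff M -> birkhoff Q ->
  ip (M - Q) (M - Q) <= 2 * n%:R.
Proof.
move=> BM BQ; have := birkhoff_ip_le BM; have := birkhoff_ip_le BQ.
have : 0 <= ip M Q.
  by case: BM BQ => M0 _ _ [Q0 _ _]; do 2 (apply: sumr_ge0 => ? _); rewrite mulr_ge0.
by rewrite ipDr !ipDl !ipNr !ipNl (ipC Q M); lra.
Qed.

Lemma continuous_sumf (T : topologicalType) (I : Type) (s : seq I) (F : I -> T -> R) :
  (forall i, continuous (F i)) -> continuous (fun x => \sum_(i <- s) F i x).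
Proof.
move=> cF; elim: s => [|i s IH] x.
  by under eq_fun do rewrite big_nil; exact: cvg_cst.
under eq_fun do rewrite big_cons.
by apply: cvgD; [exact: cF|exact: IH].
Qed.

Lemma closed_birkhoff_vec : closed [set v : 'rV[R]_(n * n) | birkhoff (vec_mx v)].
Proof.
have cE i j : continuous (fun v : 'rV[R]_(n * n) => vec_mx v i j).
  by move=> v; under eq_fun do rewrite mxE; exact: coord_continuous.
have -> : [set v : 'rV[R]_(n * n) | birkhoff (vec_mx v)] =
   (\bigcap_i \bigcap_j (fun v => vec_mx v i j) @^-1` [set x | 0 <= x]) `&`
   ((\bigcap_i (fun v => \sum_j vec_mx v i j) @^-1` [set 1]) `&`
    (\bigcap_j (fun v => \sum_i vec_mx v i j) @^-1` [set 1])).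
  apply/seteqP; split=> v.
    case=> h1 h2 h3; split; first by move=> i _ j _; exact: h1.
    by split=> i _; [exact: h2|exact: h3].
  case=> h1 [h2 h3]; split=> [i j|i|i]; [exact: h1|exact: h2|exact: h3].
apply: closedI; [|apply: closedI]; apply: closed_bigI => i _.
- apply: closed_bigI => j _; apply: closed_comp; last exact: closed_ge.
  by move=> v _; exact: cE.
- apply: closed_comp; last exact: closed_eq.
  by move=> v _; apply: continuous_sumf => j; exact: cE.
- apply: closed_comp; last exact: closed_eq.
  by move=> v _; apply: continuous_sumf => j; exact: cE.
Qed.

(** The projection onto the polytope is attained, by compactness in the space
    of vectorized matrices. *)
Lemma proj_birkhoff_argmin Y : @birkhoff R n !=set0 ->
  argmin (fun Z => frob (Y - Z)) (@birkhoff R n) (Defs.proj (@birkhoff R n) Y).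
Proof.
move=> [M0 BM0]; rewrite /Defs.proj; case: xgetP => [Z ->//|none].
exfalso.
pose A := [set v : 'rV[R]_(n * n) | birkhoff (vec_mx v)].
have cA : compact A.
  apply: bounded_closed_compact; last exact: closed_birkhoff_vec.
  exists 1; split; first by rewrite real1.
  move=> x x1 v Av /=; rewrite [leLHS]/Num.norm/= mx_normrE; apply/bigmax_leP.
  split=> [|[i j] _ /=]; first by apply: ltW; exact: lt_trans x1.
  have [k [l ->]] : exists k l, j = mxvec_index k l.
    by case/mxvec_indexP: j => k l; exists k, l.
  have -> : v i (mxvec_index k l) = vec_mx v k l by rewrite mxE ord1.
  have [v0 _ _] := Av.
  by rewrite ger0_norm// (le_trans (birkhoff_le1 _ _ Av))// ltW.
have A0 : A !=set0 by exists (mxvec M0); rewrite /A/= mxvecK.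
have [|v Av minv] :=
    @EVT_min_rV R _ (fun v => ip (Y - vec_mx v) (Y - vec_mx v)) A A0 cA.
  apply: continuous_subspaceT; apply: continuous_sumf => i; apply: continuous_sumf => j v.
  have cij : {for v, continuous (fun v : 'rV[R]_(n * n) => (Y - vec_mx v) i j)}.
    have -> : (fun v : 'rV[R]_(n * n) => (Y - vec_mx v) i j) =
        (fun v => Y i j - v 0 (mxvec_index i j)).
      by apply/funext => w; rewrite !mxE.
    exact: (cvgB (cvg_cst _) (@coord_continuous _ _ _ 0 (mxvec_index i j) v)).
  exact: (cvgM cij cij).
move: Av; rewrite inE => Av.
apply: (none (vec_mx v)); split=> // Q BQ.
rewrite -(@ler_pXn2r _ 2) ?nnegrE ?frob_ge0// !frob_sqr.
by have := minv (mxvec Q); rewrite mxvecK; apply; rewrite inE/= /A/= mxvecK.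
Qed.

Lemma proj_birkhoff_in Y : @birkhoff R n !=set0 ->
  birkhoff (Defs.proj (@birkhoff R n) Y).
Proof. by move=> /(proj_birkhoff_argmin Y)[]. Qed.

Lemma proj_birkhoff_obtuse Y Q : birkhoff Q ->
  ip (Y - Defs.proj (@birkhoff R n) Y) (Q - Defs.proj (@birkhoff R n) Y) <= 0.
Proof.
move=> BQ; have [//|BP minP] := @proj_birkhoff_argmin Y; first by exists Q.
apply: (@quad_argmin_first_order R _ ip ipC ipDr ipZr (@birkhoff R n)).
- by move=> t; exact: birkhoff_segment.
- move=> Z BZ; rewrite -!frob_sqr ler_pXn2r ?nnegrE ?frob_ge0//; exact: minP.
Qed.

End Birkhoff.

(** * Projected gradient descent for a quadratic form *)

Section ProjectedGradient.
Context {R : realType} {n : nat}.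
Variable b : 'M[R]_n -> 'M[R]_n -> R.
Hypothesis bC : forall X Y, b X Y = b Y X.
Hypothesis bD : forall X Y Z, b X (Y + Z) = b X Y + b X Z.
Hypothesis bZ : forall a X Y, b X (a *: Y) = a * b X Y.

Let f X := b X X.

Lemma quad_derive M D : 'D_D f M = 2 * b M D.
Proof.
rewrite /derive; apply: cvg_lim => //.
have -> : (fun h : R => h^-1 *: ((f \o shift M) (h *: D) - f M)) =
  (fun h => h^-1 *: (h * (2 * b M D + h * f D))).
  apply/funext => h; congr (_ *: _) => /=.
  by rewrite /f [_ *: D + M]addrC (quad_expand bC bD M) !bZ (bC (_ *: D)) bZ; ring.
have : (2 * b M D + h * f D) @[h --> (0:R)^'] --> 2 * b M D + 0 * f D.
  apply: cvgD; first exact: cvg_cst.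
  by apply: cvgM; [exact: nbhs_dnbhs|exact: cvg_cst].
rewrite mul0r addr0; apply: cvg_trans.
apply: near_eq_cvg; near=> h.
have h0 : h != 0 by near: h; exact: nbhs_dnbhs_neq.
by rewrite /GRing.scale/= mulrA mulVf// mul1r.
Unshelve. all: by end_near. Qed.

Lemma form_sum (I : Type) (s : seq I) (F : I -> 'M[R]_n) X :
  b X (\sum_(i <- s) F i) = \sum_(i <- s) b X (F i).
Proof.
elim: s => [|i s IH]; last by rewrite !big_cons bD IH.
by rewrite !big_nil -(scale0r 0) bZ mul0r.
Qed.

Lemma ip_gradient M D : ip (gradient f M) D = 2 * b M D.
Proof.
rewrite [X in b M X]matrix_sum_delta form_sum mulr_sumr.
apply: eq_bigr => i _; rewrite form_sum mulr_sumr; apply: eq_bigr => j _.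
by rewrite mxE quad_derive bZ; ring.
Qed.

Variables (mu L eta : R).
Hypothesis b_ge0 : forall X, 0 <= b X X.
Hypothesis b_smooth : forall X, 2 * b X X <= L * ip X X.
Hypothesis b_strong : forall X, mu * ip X X <= b X X.
Hypothesis L0 : 0 < L.
Hypothesis eta0 : 0 < eta.
Hypothesis etaL : eta <= L^-1.

(** One step decreases the squared distance to any feasible Z by at least
    2 eta times the gap f Y - f Z. With Z = X this is the descent property, with
    Z the minimizer it is the telescoping inequality. *)
Lemma pgd_step X Y Z : birkhoff X -> birkhoff Z ->
  Y = Defs.proj (@birkhoff R n) (X - eta *: gradient f X) ->
  2 * eta * (f Y - f Z) <= ip (X - Z) (X - Z) - ip (Y - Z) (Y - Z).
Proof.
move=> BX BZ YE.
have hproj := proj_birkhoff_obtuse (X - eta *: gradient f X) BZ.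
rewrite -YE in hproj.
have {hproj} h1 : ip (X - Y) (Z - Y) <= 2 * eta * b X (Z - Y).
  move: hproj; rewrite addrAC (ipDl (X - Y)) (ipNl (eta *: _)) ipZl ip_gradient; lra.
have h2 : f Y = f X + 2 * b X (Y - X) + f (Y - X).
  by rewrite /f -(quad_expand bC bD) addrCA subrr addr0.
have h3 : f Z = f X + 2 * b X (Z - X) + f (Z - X).
  by rewrite /f -(quad_expand bC bD) addrCA subrr addr0.
have h4 : b X (Y - X) = b X (Z - X) - b X (Z - Y).
  have -> : Z - X = (Y - X) + (Z - Y) by rewrite [RHS]addrC subrKA.
  by rewrite (bD X (Y - X)) addrK.
have h5 : ip (X - Z) (X - Z) =
    ip (X - Y) (X - Y) - 2 * ip (X - Y) (Z - Y) + ip (Y - Z) (Y - Z).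
  have -> : X - Z = (X - Y) + (Y - Z) by rewrite subrKA.
  rewrite (quad_expand ipC ipDr (X - Y)) -(opprB Z Y) ipNr (quadN ipC ipZr); ring.
have h6 : 2 * eta * f (Y - X) <= ip (X - Y) (X - Y).
  rewrite -(opprB X Y) /f (quadN bC bZ).
  apply: (@le_trans _ _ (eta * (L * ip (X - Y) (X - Y)))).
    by rewrite (mulrC 2) -mulrA ler_wpM2l ?b_smooth// ltW.
  rewrite mulrA ler_piMl ?ip_ge0//.
  by rewrite -(mulVf (lt0r_neq0 L0)) ler_pM2r.
have h7 : 0 <= 2 * eta * f (Z - X) by rewrite !mulr_ge0 ?b_ge0// ltW.
have -> : 2 * eta * (f Y - f Z) = 2 * eta * f (Y - X) - 2 * (2 * eta * b X (Z - Y))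
   - 2 * eta * f (Z - X) by rewrite h2 h3 h4; ring.
rewrite h5; lra.
Qed.

Lemma pgd_birkhoff M0 k : birkhoff M0 -> birkhoff (pgd f eta M0 k).
Proof.
by move=> B0; case: k => // k; rewrite /pgd iterS; apply: proj_birkhoff_in; exists M0.
Qed.

Lemma pgd_value_gap M' M0 k : argmin f (@birkhoff R n) M' -> birkhoff M0 ->
  2 * eta * k%:R * (f (pgd f eta M0 k) - f M') <=
    ip (M0 - M') (M0 - M') - ip (pgd f eta M0 k - M') (pgd f eta M0 k - M').
Proof.
move=> [B' _] B0; elim: k => [|k IH]; first by rewrite mulr0 mul0r /pgd/= subrr.
have Bk := pgd_birkhoff k B0.
have desc := @pgd_step _ (pgd f eta M0 k.+1) _ Bk Bk erefl.
have step := @pgd_step _ (pgd f eta M0 k.+1) _ Bk B' erefl.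
set y := pgd f eta M0 k.+1 in desc step *; set x := pgd f eta M0 k in IH desc step *.
have {}desc : f y <= f x.
  rewrite -subr_le0 -(pmulr_rle0 _ (_ : 0 < 2 * eta)) ?mulr_gt0//.
  apply: le_trans desc _.
  by rewrite subrr subr_le0 (_ : ip 0 0 = 0) ?ip_ge0// -(scale0r 0) ipZr mul0r.
have : 2 * eta * k%:R * (f y - f M') <= 2 * eta * k%:R * (f x - f M').
  by rewrite ler_wpM2l ?lerB// !mulr_ge0// ltW.
rewrite -natr1; lra.
Qed.

(** Quadratic growth of the objective around its minimizer. *)
Lemma argmin_growth M' Q : argmin f (@birkhoff R n) M' -> birkhoff Q ->
  mu * ip (Q - M') (Q - M') <= f Q - f M'.
Proof.
move=> [B' min'] BQ.
have := @quad_argmin_first_order R _ b bC bD bZ (@birkhoff R n) 0 M' Q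
  (fun t => birkhoff_segment B' BQ).
rewrite sub0r (quadN bC bZ) => first_order.
have {first_order} h : b (- M') (Q - M') <= 0.
  by apply: first_order => Z BZ; rewrite sub0r (quadN bC bZ); exact: min'.
have {}h : 0 <= b M' (Q - M').
  by move: h; rewrite bC -scaleN1r bZ bC mulN1r oppr_le0.
apply: le_trans (b_strong _) _.
have -> : f Q = f M' + 2 * b M' (Q - M') + f (Q - M').
  by rewrite /f -(quad_expand bC bD) addrCA subrr addr0.
rewrite /f; lra.
Qed.

Lemma pgd_dist M' M0 k : argmin f (@birkhoff R n) M' -> birkhoff M0 ->
  mu * eta * k%:R * ip (pgd f eta M0 k - M') (pgd f eta M0 k - M') <= n%:R.
Proof.
move=> A' B0; have gap := pgd_value_gap k A' B0.
have := argmin_growth A' (pgd_birkhoff k B0).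
have diam := birkhoff_diameter B0 A'.1.
set w := ip (_ - M') _ => growth.
have w0 : 0 <= w by exact: ip_ge0.
have : eta * k%:R * (mu * w) <= eta * k%:R * (f (pgd f eta M0 k) - f M').
  by rewrite ler_wpM2l// mulr_ge0// ltW.
rewrite (_ : mu * eta * k%:R * w = eta * k%:R * (mu * w)); last by ring.
move: gap; rewrite -/w; lra.
Qed.

End ProjectedGradient.

(** * The graph matching objective *)

Section ObjectiveAsQuadraticForm.
Context {R : realType}.

Lemma sum_Cauchy_Schwarz (I : finType) (a x : I -> R) :
  (\sum_k a k * x k) ^+ 2 <= (\sum_k a k ^+ 2) * (\sum_k x k ^+ 2).
Proof.
have : 0 <= \sum_k \sum_l (a k * x l - a l * x k) ^+ 2.
  by do 2 (apply: sumr_ge0 => ? _); exact: sqr_ge0.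
have -> : \sum_k \sum_l (a k * x l - a l * x k) ^+ 2 =
    \sum_k \sum_l (a k ^+ 2 * x l ^+ 2) + \sum_k \sum_l (a l ^+ 2 * x k ^+ 2)
    - 2 * \sum_k \sum_l ((a k * x k) * (a l * x l)).
  rewrite -big_split mulr_sumr -sumrB; apply: eq_bigr => k _ /=.
  rewrite -big_split mulr_sumr -sumrB; apply: eq_bigr => l _ /=.
  by ring.
rewrite (exchange_big _ _ _ _ _ (fun k l => a l ^+ 2 * x k ^+ 2)) /=.
rewrite expr2 !big_distrlr /=; lra.
Qed.

Lemma ip_mulmx_le m n p (A : 'M[R]_(m, n)) (X : 'M[R]_(n, p)) :
  ip (A *m X) (A *m X) <= ip A A * ip X X.
Proof.
have -> : ip A A * ip X X =
    \sum_i \sum_j (\sum_k A i k ^+ 2) * (\sum_k X k j ^+ 2).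
  rewrite /ip mulr_suml; apply: eq_bigr => i _.
  rewrite (exchange_big _ _ _ _ _ (fun k j => X k j * X k j)) mulr_sumr /=.
  by apply: eq_bigr => j _; congr (_ * _); apply: eq_bigr => k _; rewrite expr2.
apply: ler_sum => i _; apply: ler_sum => j _.
by rewrite -expr2 mxE; exact: sum_Cauchy_Schwarz.
Qed.

Lemma ip_commutator_le n (A B X : 'M[R]_n) :
  ip (A *m X - X *m B) (A *m X - X *m B) <= 2 * (ip A A + ip B B) * ip X X.
Proof.
have h1 := ip_mulmx_le A X; have h2 := ip_mulmx_le X B.
have h3 := ip_ge0 (A *m X + X *m B).
move: h3; rewrite (quad_expand ipC ipDr) => h3.
rewrite (quad_expand ipC ipDr) (quadN ipC ipZr) ipNr; lra.
Qed.

Variables (n d : nat) (g1 g2 : featured_graph R n d).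
Implicit Types (l : R) (X Y Z : 'M[R]_n).

Let comm (A B X : 'M[R]_n) := A *m X - X *m B.

Let commD A B X Y : comm A B (X + Y) = comm A B X + comm A B Y.
Proof. by rewrite /comm mulmxDr mulmxDl opprD addrACA. Qed.

Let commZ A B a X : comm A B (a *: X) = a *: comm A B X.
Proof. by rewrite /comm -scalemxAr -scalemxAl scalerBr. Qed.

(** The symmetric bilinear form whose diagonal is the objective with mixing
    weight l. *)
Definition objective_form l X Y : R :=
  l * ip (adj g1 *m X - X *m adj g2) (adj g1 *m Y - Y *m adj g2) +
  (1 - l) * \sum_(i < d) ip (feat_diag g1 i *m X - X *m feat_diag g2 i)
                            (feat_diag g1 i *m Y - Y *m feat_diag g2 i).

Lemma objective_formE rho r X :
  objective rho r g1 g2 X = objective_form (lam rho r) X X.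
Proof.
rewrite /objective frob_sqr; congr (_ + _ * _).
by apply: eq_bigr => i _; rewrite frob_sqr.
Qed.

Lemma objective_formC l X Y : objective_form l X Y = objective_form l Y X.
Proof.
rewrite /objective_form ipC; congr (_ + _ * _).
by apply: eq_bigr => i _; rewrite ipC.
Qed.

Lemma objective_formD l X Y Z :
  objective_form l X (Y + Z) = objective_form l X Y + objective_form l X Z.
Proof.
rewrite /objective_form -!/(comm _ _ _) commD ipDr.
under eq_bigr do rewrite -!/(comm _ _ _) commD ipDr.
by rewrite big_split/=; rewrite /comm; ring.
Qed.

Lemma objective_formZ l a X Y :
  objective_form l X (a *: Y) = a * objective_form l X Y.
Proof.
rewrite /objective_form -!/(comm _ _ _) commZ ipZr.
under eq_bigr do rewrite -!/(comm _ _ _) commZ ipZr.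
by rewrite -mulr_sumr /comm; ring.
Qed.

Lemma objective_form_ge0 l X : 0 <= l <= 1 -> 0 <= objective_form l X X.
Proof.
move=> /andP[l0 l1]; rewrite addr_ge0// mulr_ge0 ?ip_ge0 ?subr_ge0//.
by apply: sumr_ge0 => i _; exact: ip_ge0.
Qed.

(** A smoothness constant valid for every mixing weight in [0, 1]. *)
Definition smoothness : R :=
  4 * (ip (adj g1) (adj g1) + ip (adj g2) (adj g2) +
    \sum_(i < d) (ip (feat_diag g1 i) (feat_diag g1 i) +
                  ip (feat_diag g2 i) (feat_diag g2 i))) + 1.

Lemma smoothness_gt0 : 0 < smoothness.
Proof.
rewrite ltr_wpDl// mulr_ge0// !addr_ge0 ?ip_ge0//.
by apply: sumr_ge0 => i _; rewrite addr_ge0 ?ip_ge0.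
Qed.

Lemma objective_form_smooth l X : 0 <= l <= 1 ->
  2 * objective_form l X X <= smoothness * ip X X.
Proof.
move=> /andP[l0 l1]; rewrite /objective_form /smoothness.
have h1 := ip_commutator_le (adj g1) (adj g2) X.
set S1 := \sum_(i < d) ip _ _; set S2 := \sum_(i < d) (_ + _).
have h2 : S1 <= 2 * S2 * ip X X.
  have e v : 2 * S2 * v = \sum_(i < d) 2 * (ip (feat_diag g1 i) (feat_diag g1 i) +
      ip (feat_diag g2 i) (feat_diag g2 i)) * v.
    by rewrite -mulrA mulr_suml mulr_sumr; apply: eq_bigr => i _; rewrite mulrA.
  by rewrite e; apply: ler_sum => i _; exact: ip_commutator_le.
have S10 : 0 <= S1 by apply: sumr_ge0 => i _; exact: ip_ge0.
have := ip_ge0 X; have := ip_ge0 (adj g1 *m X - X *m adj g2).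
move: h1 h2; set u := ip (adj g1 *m X - _) _; set v := ip X X => h1 h2 u0 v0.
have h3 : l * u <= u by rewrite ler_piMl.
have h4 : (1 - l) * S1 <= S1 by rewrite ler_piMl//; lra.
lra.
Qed.

Lemma ip_feat_commutator X :
  \sum_(i < d) ip (feat_diag g1 i *m X - X *m feat_diag g2 i)
                  (feat_diag g1 i *m X - X *m feat_diag g2 i) =
  \sum_k \sum_l (\sum_(i < d) (feat g1 k i - feat g2 l i) ^+ 2) * X k l ^+ 2.
Proof.
rewrite /ip exchange_big; apply: eq_bigr => k _ /=.
rewrite exchange_big; apply: eq_bigr => l _ /=.
rewrite mulr_suml; apply: eq_bigr => i _.
by rewrite /feat_diag mul_diag_mx mul_mx_diag !mxE; ring.
Qed.

Lemma objective_form_strong l c X : 0 <= l <= 1 ->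
  (forall k j, c <= \sum_(i < d) (feat g1 k i - feat g2 j i) ^+ 2) ->
  (1 - l) * c * ip X X <= objective_form l X X.
Proof.
move=> /andP[l0 l1] hc; rewrite /objective_form ip_feat_commutator -mulrA.
rewrite ler_wpDl ?mulr_ge0 ?ip_ge0// ler_wpM2l ?subr_ge0//.
rewrite /ip mulr_sumr; apply: ler_sum => k _.
rewrite mulr_sumr; apply: ler_sum => j _.
by rewrite -expr2 ler_wpM2r ?sqr_ge0.
Qed.

End ObjectiveAsQuadraticForm.

Lemma lam_itv (R : realType) (rho r : R) : 0 < rho < 1 -> 0 < r < 1 ->
  0 < lam rho r < 1.
Proof.
have phi0 (x : R) : 0 < x < 1 -> 0 < phi x.
  move=> /andP[x0 x1]; by rewrite divr_gt0// subr_gt0 expr_lt1 ?ltW.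
move=> /phi0 h1 /phi0 h2; rewrite /lam divr_gt0 ?addr_gt0//=.
by rewrite ltr_pdivrMr ?addr_gt0// mul1r ltrDl.
Qed.

Section DistanceBound.
Context {R : realType} {n d : nat}.

(** The deterministic half: a uniform lower bound on the squared feature
    distances makes the objective strongly convex, and the iterates of
    projected gradient descent approach its minimizer. *)
Lemma frob_pgd_le (g1 g2 : featured_graph R n d) (rho r eta : R)
    (M' M0 : 'M[R]_n) (K : nat) :
  0 < rho < 1 -> 0 < r < 1 -> (0 < n -> 0 < d)%N ->
  (forall k l, (1 - r) * d%:R <= \sum_(i < d) (feat g1 k i - feat g2 l i) ^+ 2) ->
  0 < eta <= (smoothness g1 g2)^-1 ->
  argmin (objective rho r g1 g2) (@birkhoff R n) M' -> birkhoff M0 -> (1 <= K)%N ->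
  frob (pgd (objective rho r g1 g2) eta M0 K - M') <=
  Num.sqrt (n%:R / ((1 - lam rho r) * (1 - r) * d%:R * eta * K%:R)).
Proof.
move=> rho01 r01 nd far /andP[eta0 etaL] argM' BM0 K1.
have /andP[l0 l1] := lam_itv rho01 r01; set l := lam rho r in l0 l1 *.
have l01 : 0 <= l <= 1 by rewrite !ltW.
have [n0|n0] := posnP n.
  suff -> : frob (pgd (objective rho r g1 g2) eta M0 K - M') = 0 by exact: sqrtr_ge0.
  rewrite /frob big1 ?sqrtr0// => i _.
  by have := ltn_ord i; rewrite [X in (_ < X)%N]n0.
have objE : objective rho r g1 g2 = (fun X => objective_form g1 g2 l X X).
  by apply/funext => X; exact: objective_formE.
rewrite objE in argM' *.
set D := pgd _ _ _ _ - M'.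
have dist : (1 - l) * ((1 - r) * d%:R) * eta * K%:R * ip D D <= n%:R.
  apply: (pgd_dist (objective_formC g1 g2 l) (objective_formD g1 g2 l)
    (objective_formZ g1 g2 l) (L := smoothness g1 g2)) => //.
  - by move=> X; exact: objective_form_ge0.
  - by move=> X; exact: objective_form_smooth.
  - by move=> X; exact: objective_form_strong.
  - exact: smoothness_gt0.
have d0 : 0 < d%:R :> R by rewrite ltr0n nd.
have K0 : 0 < K%:R :> R by rewrite ltr0n.
have r1 : 0 < 1 - r by rewrite subr_gt0; case/andP: r01.
have -> : frob D = Num.sqrt (ip D D) by rewrite -frob_sqr sqrtr_sqr ger0_norm ?frob_ge0.
have l1' : 0 < 1 - l by rewrite subr_gt0.
apply: ler_wsqrtr; rewrite ler_pdivlMr; last by rewrite !mulr_gt0.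
by rewrite mulrC -(mulrA (1 - l)).
Qed.

End DistanceBound.

(** * Characteristic function of the centered normal law *)

Section NormalCharacteristicFunction.
Context {R : realType}.
Variable s : R.
Hypothesis s0 : 0 < s.
Local Notation mu := (@lebesgue_measure R).
Let w : R -> R := normal_pdf 0 s.
Let c : R := normal_peak s.

Let s_neq0 : s != 0. Proof. by rewrite gt_eqF. Qed.

Lemma normal_pdf_centeredE x :
  normal_pdf 0 s x = normal_peak s * expR (- (x ^+ 2 / (s ^+ 2 *+ 2))).
Proof. by rewrite normal_pdfE// /normal_fun subr0 mulNr. Qed.

Let w_ge0 x : 0 <= w x. Proof. exact: normal_pdf_ge0. Qed.
Let mw : measurable_fun setT w. Proof. exact: measurable_normal_pdf. Qed.

(** Integration against a centered normal law is integration against its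
    density. *)
Lemma integral_normal_prob (f : R -> R) (M : R) : measurable_fun setT f ->
  (forall x, `|f x| <= M) ->
  (\int[normal_prob 0 s]_x (f x)%:E = \int[mu]_x (f x * normal_pdf 0 s x)%:E)%E.
Proof.
move=> mf fM.
have dom : normal_prob 0 s `<< mu by exact: normal_prob_dominates.
have intf : (normal_prob 0 s).-integrable setT (EFin \o f).
  apply: measurable_bounded_integrable => //.
    by rewrite [ltLHS](@probability_setT _ _ _ (normal_prob 0 s)) ltry.
  by exists M; split; [exact: num_real|move=> x Mx y _; exact: le_trans (fM y) (ltW Mx)].
rewrite -(Radon_Nikodym_change_of_variables dom)//.
apply: ae_eq_integral => //.
- apply: emeasurable_funM; first exact/measurable_EFinP.
  by apply: (measurable_int mu); exact: Radon_Nikodym_integrable.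
- by apply/measurable_EFinP; apply: measurable_funM.
- under [X in ae_eq _ _ _ X]eq_fun do rewrite EFinM.
  apply: ae_eqe_mul2l => /=.
  rewrite Radon_NikodymE//=.
  case: cid => /= h [h1 h2 h3].
  apply: integral_ae_eq => //=.
  + by apply/measurable_EFinP.
  + by move=> E E01 mE; rewrite -h3.
Qed.

Let integrable_w : mu.-integrable setT (EFin \o w).
Proof. exact: integrable_normal_pdf. Qed.

Let integrable_bounded_w (f : R -> R) (M : R) : measurable_fun setT f ->
  (forall x, `|f x| <= M) -> mu.-integrable setT (EFin \o (fun x => f x * w x)).
Proof.
move=> mf fM.
apply: (@le_integrable _ _ _ mu setT measurableT _ (EFin \o (fun x => M * w x))).
- by apply/measurable_EFinP; exact: measurable_funM.
- move=> x _; rewrite /= lee_fin !normrM ler_wpM2r//.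
  exact: le_trans (fM x) (ler_norm _).
- by rewrite (_ : _ \o _ = (fun x => M%:E * (w x)%:E)%E)//; exact: integrableZl.
Qed.

(* |y| <= 1 + y^2/4 <= exp(y^2/4) with y = x/s: a linear factor is absorbed by
   doubling the variance. *)
Let integrable_xw : mu.-integrable setT (EFin \o (fun x => `|x| * w x)).
Proof.
pose s' := s * Num.sqrt 2.
have s'0 : s' != 0 by rewrite mulf_neq0// gt_eqF// sqrtr_gt0.
have s'2 : s' ^+ 2 = s ^+ 2 *+ 2 by rewrite exprMn sqr_sqrtr// mulr_natr.
have p0 : 0 < normal_peak s' by exact: normal_peak_gt0.
have c0 : 0 < c by exact: normal_peak_gt0.
have [K [K0 KE]] : exists K, 0 <= K /\ K * normal_peak s' = s * c.
  exists (s * c / normal_peak s'); split; last by rewrite divfK// gt_eqF.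
  by rewrite divr_ge0 ?mulr_ge0// ltW.
apply: (@le_integrable _ _ _ mu setT measurableT _
  (EFin \o (fun x => K * normal_pdf 0 s' x))).
- by apply/measurable_EFinP; apply: measurable_funM => //; exact: measurableT_comp.
- move=> x _; rewrite /= lee_fin !normrM normr_id !(ger0_norm (normal_pdf_ge0 _ _ _)).
  rewrite /w normal_pdf_centeredE normal_pdfE// /normal_fun subr0 s'2.
  rewrite (ger0_norm K0) (mulrA K) KE (mulrC s) -(mulrA c).
  rewrite mulrCA ler_pM2l//.
  pose q := (x / s) ^+ 2 / 4.
  have -> : - (x ^+ 2 / (s ^+ 2 *+ 2)) = - q - q.
    by rewrite /q -mulr_natr; field.
  have -> : - x ^+ 2 / (s ^+ 2 *+ 2 *+ 2) = - q.
    by rewrite /q -mulrnA -mulr_natr; field.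
  rewrite expRD (mulrA `|x|) ler_pM2r ?expR_gt0// expRN ler_pdivrMr ?expR_gt0//.
  apply: (@le_trans _ _ (s * (1 + q))); last by rewrite ler_pM2l// expR_ge1Dx.
  have xE : x = s * (x / s) by rewrite mulrCA divff ?mulr1.
  rewrite [in `|x|]xE normrM (gtr0_norm s0) ler_pM2l// /q; set y := x / s.
  have : 0 <= (`|y| / 2 - 1) ^+ 2 by exact: sqr_ge0.
  have -> : (`|y| / 2 - 1) ^+ 2 = `|y| ^+ 2 / 4 - `|y| + 1 by field.
  by rewrite real_normK ?num_real//; lra.
- rewrite (_ : _ \o _ = (fun x => K%:E * (normal_pdf 0 s' x)%:E)%E)//.
  by apply: integrableZl => //; exact: integrable_normal_pdf.
Qed.

Let measurable_cosM (a : R) : measurable_fun setT (fun x : R => cos (a * x)).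
Proof.
apply: continuous_measurable_fun => x; apply: continuous_comp; last exact: continuous_cos.
exact: mulrl_continuous.
Qed.

Let measurable_sinM (a : R) : measurable_fun setT (fun x : R => sin (a * x)).
Proof.
apply: continuous_measurable_fun => x; apply: continuous_comp; last exact: continuous_sin.
exact: mulrl_continuous.
Qed.

Let integrable_cos a : mu.-integrable setT (EFin \o (fun x => cos (a * x) * w x)).
Proof. by apply: (@integrable_bounded_w _ 1) => // x; exact: cos_max. Qed.

Let integrable_xsin a :
  mu.-integrable setT (EFin \o (fun x => x * sin (a * x) * w x)).
Proof.
apply: (@le_integrable _ _ _ mu setT measurableT _ _ _ _ integrable_xw).
- by apply/measurable_EFinP; do 2 apply: measurable_funM => //; exact: measurable_sinM.
- move=> x _; rewrite /= lee_fin !normrM normr_id ler_wpM2r//.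
  by rewrite ler_piMr ?sin_max.
Qed.

Let is_derive_w x : is_derive x (1 : R) w (- (x / s ^+ 2) * w x).
Proof.
pose k : R := - (s ^+ 2 *+ 2)^-1.
have -> : w = (fun y => c * expR (k * (y * y))).
  apply/funext => y; rewrite /w normal_pdf_centeredE /k; congr (_ * expR _).
  by rewrite mulNr mulrC -expr2.
have h2 : is_derive x (1 : R) (fun y : R => y * y) (x *: (1 : R) + x *: (1 : R)).
  exact: (@is_deriveM _ _ id id).
have h3 := @is_deriveZ _ _ _ (fun y : R => y * y) k _ _ _ h2.
have h4 := is_derive1_comp (is_derive_expR _) h3.
have h5 := @is_deriveZ _ _ _ _ c _ _ _ h4.
apply: (trigger_derive h5).
rewrite /GRing.scale/= /k -mulr_natr; field.
exact: s_neq0.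
Qed.

(* The primitive G of g vanishes at infinity, which makes the integral of g
   zero: this is the integration by parts behind the differential equation
   psi' a = - s^2 a psi a. *)
Let G a x : R := sin (a * x) * w x.
Let g a x : R := a * (cos (a * x) * w x) - (s ^- 2) * (x * sin (a * x) * w x).

Let is_derive_G a x : is_derive x (1 : R) (G a) (g a x).
Proof.
have h1 : is_derive x (1 : R) (fun y : R => a * y) (a *: (1 : R)).
  exact: (@is_deriveZ _ _ _ id a).
have h2 := is_derive1_comp (is_derive_sin _) h1.
have h3 := is_deriveM h2 (is_derive_w x).
apply: (trigger_derive h3).
rewrite /g /GRing.scale/=; field.
exact: s_neq0.
Qed.

Let integrable_g a : mu.-integrable setT (EFin \o g a).
Proof.
rewrite (_ : _ \o _ = ((fun x => a%:E * (cos (a * x) * w x)%:E) \-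
  (fun x => (s ^- 2)%:E * (x * sin (a * x) * w x)%:E))%E)//.
by apply: integrableB => //; apply: integrableZl => //;
  [exact: integrable_cos|exact: integrable_xsin].
Qed.

Let continuous_g a : continuous (g a).
Proof.
have cw : continuous w by exact: continuous_normal_pdf.
have cc f : continuous f -> continuous (fun x : R => f (a * x) : R).
  move=> cf x; apply: continuous_comp; last exact: cf.
  exact: mulrl_continuous.
move=> x; apply: cvgB; apply: cvgM; try exact: cvg_cst.
  apply: cvgM; last exact: cw.
  by apply: (cc cos); exact: continuous_cos.
apply: cvgM; last exact: cw.
apply: cvgM; first exact: cvg_id.
by apply: (cc sin); exact: continuous_sin.
Qed.

Let cvg_w : w n.+1%:R @[n --> \oo] --> (0 : R).
Proof.
pose k : R := (s * Num.sqrt 2)^-1.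
have k0 : 0 < k by rewrite invr_gt0 mulr_gt0// sqrtr_gt0.
have wE x : w x = c * gauss_fun (k * x).
  rewrite /w normal_pdf_centeredE /gauss_fun; congr (_ * expR (- _)).
  by rewrite exprMn exprVn exprMn sqr_sqrtr// mulr_natr mulrC.
rewrite (_ : (fun n => _) = (fun n : nat => c * gauss_fun (k * n.+1%:R))); last first.
  by apply/funext => n; exact: wE.
rewrite -(mulr0 c); apply: cvgM; first exact: cvg_cst.
rewrite (cvg_shiftS (fun n : nat => gauss_fun (k * n%:R))).
apply: (cvg_comp (fun n : nat => n%:R) (fun x : R => gauss_fun (k * x)) cvgr_idn).
apply: (cvg_comp (fun x : R => k * x) gauss_fun _ cvg_gauss_fun).
by apply: gt0_cvgMry => //; exact: cvg_id.
Qed.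

Let integral_g a : (\int[mu]_x (g a x)%:E = 0)%E.
Proof.
pose I (n : nat) : set R := `[- n.+1%:R, n.+1%:R]%classic.
have mg : measurable_fun setT (g a).
  by apply: continuous_measurable_fun; exact: continuous_g.
have cvg1 : (\int[mu]_x ((g a \_ (I n)) x)%:E)%E @[n --> \oo] -->
    (\int[mu]_x (g a x)%:E)%E.
  apply: (@dominated_cvg _ _ _ mu setT measurableT _ _ (fun x => `|(g a x)%:E|%E)).
  - move=> n; apply/measurable_EFinP.
    apply: (measurable_restrictT _ (measurable_itv _)).1.
    exact: measurable_funTS.
  - move=> x _; apply: cvg_near_cst; near=> n.
    rewrite patchE mem_set// /I/= in_itv/= -ler_norml.
    apply: le_trans (_ : n%:R <= _); last by rewrite ler_nat.
    by near: n; exact: nbhs_infty_ger.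
  - by [].
  - by apply: integrable_abse; exact: integrable_g.
  - move=> n x _; rewrite lee_fin patchE; case: ifP => // _.
    by rewrite normr0.
have intI n : (\int[mu]_x ((g a \_ (I n)) x)%:E = (2 * G a n.+1%:R)%:E)%E.
  have -> : (fun x => ((g a \_ (I n)) x)%:E) = (EFin \o g a) \_ (I n).
    by rewrite restrict_EFin.
  rewrite -integral_mkcond.
  rewrite (@continuous_FTC2 _ (g a) (G a)).
  - rewrite -EFinB; congr EFin.
    rewrite /G mulrN sinN mulNr opprK mulr_natl mulr2n; congr (_ + _ * _).
    by rewrite /w !normal_pdf_centeredE sqrrN.
  - by rewrite gtrN.
  - by apply: continuous_subspaceT; exact: continuous_g.
  - have cG x : {for x, continuous (G a)}.
      apply: differentiable_continuous; apply/derivable1_diffP.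
      exact: (@ex_derive _ _ _ _ _ _ _ (is_derive_G a x)).
    split => [x _||].
    + exact: (@ex_derive _ _ _ _ _ _ _ (is_derive_G a x)).
    + exact: cvg_at_right_filter (cG _).
    + exact: cvg_at_left_filter (cG _).
  - by move=> x _; rewrite derive1E; exact: (@derive_val _ _ _ _ _ _ _ (is_derive_G a x)).
have cvg2 : (\int[mu]_x ((g a \_ (I n)) x)%:E)%E @[n --> \oo] --> (0 : \bar R)%E.
  under eq_fun do rewrite intI.
  apply: cvg_EFin; first exact: nearW.
  rewrite -(mulr0 2); apply: cvgM; first exact: cvg_cst.
  apply/norm_cvg0P; apply: (squeeze_cvgr _ (cvg_cst 0) cvg_w).
  near=> n; rewrite normr_ge0/= /G normrM (ger0_norm (w_ge0 _)).
  by rewrite ler_piMl// sin_max.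
exact: (cvg_unique _ cvg1 cvg2).
Unshelve. all: by end_near.
Qed.

(* The characteristic function; it is real since the law is symmetric. *)
Let psi a := (\int[mu]_x (cos (a * x) * w x))%R.

Let integral_xsin a : (\int[mu]_x (x * sin (a * x) * w x))%R = s ^+ 2 * a * psi a.
Proof.
have : (\int[mu]_x (g a x) = 0)%R by rewrite /Rintegral integral_g.
have ic := integrable_cos a; have isn := integrable_xsin a.
rewrite /g RintegralB//; last 2 first.
- rewrite (_ : _ \o _ = (fun x => a%:E * (cos (a * x) * w x)%:E)%E)//.
  exact: integrableZl.
- rewrite (_ : _ \o _ = (fun x => (s ^- 2)%:E * (x * sin (a * x) * w x)%:E)%E)//.
  exact: integrableZl.
rewrite !RintegralZl// -/(psi a).
set J := Rintegral _ _ _ => /eqP; rewrite subr_eq0 => /eqP e.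
by rewrite -mulrA e mulrA divff ?mul1r// expf_neq0.
Qed.

Let is_derive_psi a : is_derive a (1 : R) psi (- (s ^+ 2 * a * psi a)).
Proof.
pose F b x := cos (b * x) * w x.
have dF b x : is_derive b (1 : R) (F^~ x) (- (x * sin (b * x) * w x)).
  have h1 : is_derive b (1 : R) (fun y : R => x * y) (x *: (1 : R)).
    exact: (@is_deriveZ _ _ _ id x).
  have h2 := is_derive1_comp (is_derive_cos _) h1.
  have h3 := @is_deriveZ _ _ _ _ (w x) _ _ _ h2.
  have -> : F^~ x = (fun y => w x *: (cos \o (fun y => x * y)) y).
    by apply/funext => y; rewrite /F/= /GRing.scale/= mulrC (mulrC y).
  apply: (trigger_derive h3).
  by rewrite /GRing.scale/= (mulrC x b); ring.
have Ia : `]a - 1, a + 1[%classic a by rewrite /= in_itv/=; lra.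
have dF' b x : `]a - 1, a + 1[%classic b -> setT x -> derivable (F^~ x) b 1.
  by move=> _ _; exact: (@ex_derive _ _ _ _ _ _ _ (dF b x)).
have p1 b x : partial1of2 F b x = - (x * sin (b * x) * w x).
  by rewrite partial1of2E; exact: (@derive_val _ _ _ _ _ _ _ (dF b x)).
have FG b x : `]a - 1, a + 1[%classic b -> setT x -> `|partial1of2 F b x| <= `|x| * w x.
  move=> _ _; rewrite p1 normrN !normrM (ger0_norm (w_ge0 x)) ler_wpM2r//.
  by rewrite ler_piMr ?sin_max.
have G0 x : 0 <= `|x| * w x by rewrite mulr_ge0.
have iF b : `]a - 1, a + 1[%classic b -> mu.-integrable setT (EFin \o F b).
  by move=> _; exact: integrable_cos.
have der := derivable_under_integral measurableT Ia iF dF' G0 integrable_xw FG.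
have val := differentiation_under_integral measurableT Ia iF dF' G0 integrable_xw FG.
apply: DeriveDef; first exact: der.
rewrite -derive1E val.
under eq_Rintegral do rewrite p1 -mulN1r.
by rewrite RintegralZl// integral_xsin mulN1r.
Qed.

Let psi0 : psi 0 = 1.
Proof.
rewrite /psi; under eq_Rintegral do rewrite mul0r cos0 mul1r.
by rewrite /Rintegral integral_normal_pdf.
Qed.

Let psiE a : psi a = expR (- (s ^+ 2 * a ^+ 2 / 2)).
Proof.
pose k := s ^+ 2 / 2.
have dE b : is_derive b (1 : R) (fun b => expR (k * (b * b)))
    (expR (k * (b * b)) * (s ^+ 2 * b)).
  have h2 : is_derive b (1 : R) (fun y : R => y * y) (b *: (1 : R) + b *: (1 : R)).
    exact: (@is_deriveM _ _ id id).
  have h3 := @is_deriveZ _ _ _ (fun y : R => y * y) k _ _ _ h2.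
  have h4 := is_derive1_comp (is_derive_expR _) h3.
  apply: (trigger_derive h4).
  by rewrite /GRing.scale/= /k; field.
have cst : psi a * expR (k * (a * a)) = psi 0 * expR (k * (0 * 0)).
  apply: (@is_derive_0_is_cst _ (fun b => psi b * expR (k * (b * b)))) => b.
  apply: (trigger_derive (is_deriveM (is_derive_psi b) (dE b))).
  by rewrite /GRing.scale/=; ring.
move: cst; rewrite psi0 !mulr0 expR0 mulr1 => cst.
apply: (mulIf (lt0r_neq0 (expR_gt0 (k * (a * a))))).
by rewrite cst -expRD -[LHS]expR0; congr expR; rewrite /k; field.
Qed.

Lemma integral_cos_normal_prob a :
  (\int[normal_prob 0 s]_x (cos (a * x))%:E = (expR (- (s ^+ 2 * a ^+ 2 / 2)))%:E)%E.
Proof.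
rewrite (integral_normal_prob (measurable_cosM a) (fun x => cos_max _)).
by rewrite -psiE /psi /Rintegral fineK//; exact: integrable_fin_num (integrable_cos a).
Qed.

End NormalCharacteristicFunction.

(** * Lower tail of the squared norm of a Gaussian vector *)

Lemma bounded_integrable {d} {T : measurableType d} {R : realType}
  (P : probability T R) (f : T -> R) (M : R) :
  measurable_fun setT f -> (forall w, `|f w| <= M) -> P.-integrable setT (EFin \o f).
Proof.
move=> mf fM; apply: measurable_bounded_integrable => //.
  by rewrite [ltLHS]probability_setT ltry.
by exists M; split; [exact: num_real|move=> x Mx y _; exact: le_trans (fM y) (ltW Mx)].
Qed.

Section LaplaceTransformOfSquaredNorm.
Context {R : realType} {dT : measure_display} {T : measurableType dT}.
Variable P : probability T R.

Lemma measurable_cos : measurable_fun setT (@cos R).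
Proof. by apply: continuous_measurable_fun; exact: continuous_cos. Qed.

Lemma measurable_sin : measurable_fun setT (@sin R).
Proof. by apply: continuous_measurable_fun; exact: continuous_sin. Qed.

(** For u ~ N(0, 1), the mean of exp(-u^2/2) is 1 / sqrt 2. *)
Lemma integral_expR_normal_prob :
  (\int[normal_prob 0 1]_u (expR (- (u ^+ 2 / 2)))%:E = ((Num.sqrt 2)^-1 : R)%:E)%E.
Proof.
rewrite (@integral_normal_prob _ _ (fun u => expR (- (u ^+ 2 / 2))) 1); last 2 first.
- apply: measurableT_comp => //; apply: measurableT_comp => //.
  by apply: measurable_funM => //; exact: measurable_funX.
- by move=> x; rewrite ger0_norm ?expR_ge0// expR_le1 oppr_le0 divr_ge0 ?sqr_ge0.
pose c : R := normal_peak 1.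
have e x : expR (- (x ^+ 2 / 2)) * normal_pdf 0 1 x = c * gauss_fun x.
  rewrite normal_pdf_centeredE ?ltr01// mulrCA -expRD; congr (_ * expR _).
  by rewrite expr1n; field.
under eq_integral do rewrite e EFinM.
rewrite ge0_integralZl//.
- rewrite integralT_gauss -EFinM; congr EFin.
  rewrite /c /normal_peak expr1n mul1r -mulr_natl sqrtrM// invfM -mulrA mulVf ?mulr1//.
  by rewrite gt_eqF// sqrtr_gt0 pi_gt0.
- by apply/measurable_EFinP; exact: measurable_gauss_fun.
- by move=> x _; rewrite lee_fin gauss_fun_ge0.
- by rewrite lee_fin; exact: normal_peak_ge0.
Qed.

(** Since exp(-x^2/2) is the mean of cos(u x) for u standard normal, a Gaussian
    weight can be traded for a random frequency. *)
Lemma integral_gauss_weight (Y X V : T -> R) (K : R) :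
  measurable_fun setT Y -> measurable_fun setT X -> measurable_fun setT V ->
  (forall w, `|Y w| <= 1) ->
  (forall u, \int[P]_w (Y w * cos (u * X w + V w))%:E =
    (K * expR (- (u ^+ 2 / 2)))%:E)%E ->
  (\int[P]_w (Y w * expR (- (X w ^+ 2 / 2)) * cos (V w))%:E = (K / Num.sqrt 2)%:E)%E.
Proof.
move=> mY mX mV Y1 hK.
pose N : probability _ R := normal_prob 0 1.
pose f (z : T * R) : R := Y z.1 * cos (z.2 * X z.1) * cos (V z.1).
have mf : measurable_fun setT f.
  apply: measurable_funM; last first.
    by apply: measurableT_comp; [exact: measurable_cos|exact: measurableT_comp].
  apply: measurable_funM; first exact: measurableT_comp.
  apply: measurableT_comp; first exact: measurable_cos.
  by apply: measurable_funM => //; exact: measurableT_comp.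
have intf : (P \x N)%E.-integrable setT (EFin \o f).
  apply: measurable_bounded_integrable => //.
    rewrite -setXTT [ltLHS]product_measure1E//.
    by rewrite [X in (X * _)%E]probability_setT [X in (_ * X)%E]probability_setT mule1 ltry.
  exists 1; split; [exact: num_real|move=> x x1 [w u] _ /=].
  apply: le_trans (ltW x1); rewrite !normrM.
  by rewrite -[1]mulr1 -[X in X * 1]mulr1 !ler_pM ?mulr_ge0 ?Y1 ?cos_max.
transitivity (\int[P]_w \int[N]_u (f (w, u))%:E)%E.
  apply: eq_integral => w _.
  transitivity (\int[N]_u ((Y w * cos (V w))%:E * (cos (X w * u))%:E))%E.
    rewrite integralZl//=.
      by rewrite integral_cos_normal_prob ?ltr01// -EFinM expr1n mul1r mulrAC.
    apply: (@bounded_integrable _ _ _ _ _ 1); last by move=> u; exact: cos_max.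
    by apply: measurableT_comp; [exact: measurable_cos|exact: measurable_funM].
  apply: eq_integral => u _; rewrite -EFinM /f/=; congr EFin.
  by rewrite mulrAC (mulrC u).
transitivity (\int[N]_u \int[P]_w (f (w, u))%:E)%E; first exact: (Fubini intf).
transitivity (\int[N]_u (K%:E * (expR (- (u ^+ 2 / 2)))%:E))%E; last first.
  rewrite integralZl//; first by rewrite integral_expR_normal_prob -EFinM.
  apply: (@bounded_integrable _ _ _ _ _ 1).
    apply: measurableT_comp => //; apply: measurableT_comp => //.
    by apply: measurable_funM => //; exact: measurable_funX.
  move=> u; rewrite ger0_norm ?expR_ge0// expR_le1 oppr_le0 divr_ge0 ?sqr_ge0//.
apply: eq_integral => u _ /=.
have bnd v : P.-integrable setT (EFin \o (fun w => Y w * cos (v * X w + V w))).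
  apply: (@bounded_integrable _ _ _ _ _ 1).
    apply: measurable_funM => //; apply: measurableT_comp; first exact: measurable_cos.
    by apply: measurable_funD => //; exact: measurable_funM.
  by move=> w; rewrite normrM -[1]mulr1 ler_pM ?Y1 ?cos_max.
transitivity (\int[P]_w ((2^-1 * (Y w * cos (u * X w + V w) +
    Y w * cos (- u * X w + V w)))%:E))%E.
  apply: eq_integral => w _; rewrite /f/=; congr EFin.
  by rewrite !cosD mulNr cosN sinN; field.
under eq_integral do rewrite EFinM EFinD.
rewrite integralZl//; last by apply: integrableD => //; exact: bnd.
rewrite integralD//; [|exact: bnd..].
by rewrite !hK sqrrN -EFinD -!EFinM; congr EFin; field.
Qed.

(** The standard Gaussian law on R^d enters through its one-dimensional
    projections only, in the form of its characteristic function. *)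
Lemma gaussian_laplace_sqnorm (d : nat) (X : 'I_d -> T -> R) :
  (forall i, measurable_fun setT (X i)) ->
  (forall a : 'I_d -> R, \int[P]_w (cos (\sum_i a i * X i w))%:E =
     (expR (- ((\sum_i a i ^+ 2) / 2)))%:E)%E ->
  (\int[P]_w (expR (- ((\sum_i X i w ^+ 2) / 2)))%:E = ((Num.sqrt 2 ^+ d)^-1 : R)%:E)%E.
Proof.
move=> mX hX.
(* The coordinates are extended by zero to all natural indices. *)
pose Z k := if insub k is Some i then X i else cst 0.
have ZE (i : 'I_d) : Z i = X i by rewrite /Z valK.
have mZ k : measurable_fun setT (Z k).
  by rewrite /Z; case: insubP => [i _ _|_]; [exact: mX|exact: measurable_cst].
pose Y j w := expR (- ((\sum_(0 <= i < j) Z i w ^+ 2) / 2)).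
have mY j : measurable_fun setT (Y j).
  apply: measurableT_comp => //; apply: measurableT_comp => //.
  apply: measurable_funM => //; apply: measurable_sum => i.
  exact: measurable_funX.
have Y1 j w : `|Y j w| <= 1.
  rewrite ger0_norm ?expR_ge0// expR_le1 oppr_le0 divr_ge0//.
  by apply: sumr_ge0 => i _; exact: sqr_ge0.
have mV j (c : nat -> R) : measurable_fun setT (fun w => \sum_(j <= i < d) c i * Z i w).
  by apply: measurable_sum => i; exact: measurable_funM.
(* The first j coordinates carry the Gaussian weight, the others stay in the
   trigonometric factor. *)
have main j : (j <= d)%N -> forall c : nat -> R,
    (\int[P]_w (Y j w * cos (\sum_(j <= i < d) c i * Z i w))%:E =
    ((Num.sqrt 2 ^+ j)^-1 * expR (- ((\sum_(j <= i < d) c i ^+ 2) / 2)))%:E)%E.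
  elim: j => [_ c|j IH jd c].
    rewrite expr0 invr1 mul1r big_mkord -hX; apply: eq_integral => w _.
    rewrite /Y big_nil mul0r oppr0 expR0 mul1r big_mkord.
    by congr (EFin (cos _)); apply: eq_bigr => i _; rewrite ZE.
  pose V w := \sum_(j.+1 <= i < d) c i * Z i w.
  transitivity (\int[P]_w (Y j w * expR (- (Z j w ^+ 2 / 2)) * cos (V w))%:E)%E.
    apply: eq_integral => w _; rewrite /Y -expRD big_nat_recr//= mulrDl opprD.
    by [].
  pose K := (Num.sqrt 2 ^+ j)^-1 * expR (- ((\sum_(j.+1 <= i < d) c i ^+ 2) / 2)).
  have hK u : (\int[P]_w (Y j w * cos (u * Z j w + V w))%:E =
      (K * expR (- (u ^+ 2 / 2)))%:E)%E.
    pose c' i := if i == j then u else c i.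
    have c'j : c' j = u by rewrite /c' eqxx.
    have c'E i : (j < i)%N -> c' i = c i by move=> ji; rewrite /c' gtn_eqF.
    transitivity (\int[P]_w (Y j w * cos (\sum_(j <= i < d) c' i * Z i w))%:E)%E.
      apply: eq_integral => w _; rewrite big_ltn// c'j.
      congr (_ * cos (_ + _))%:E; apply: eq_big_nat => i /andP[ji _].
      by rewrite c'E.
    rewrite IH ?(ltnW jd)// big_ltn// c'j /K -mulrA -expRD; congr (_ * expR _)%:E.
    under eq_big_nat => i /andP[ji _] do rewrite c'E//.
    by ring.
  rewrite (integral_gauss_weight (mY j) (mZ j) (mV j.+1 c) (Y1 j) hK).
  by congr EFin; rewrite /K exprSr invfM; ring.
have := main d (leqnn d) (fun=> 0).
rewrite big_geq// mul0r oppr0 expR0 mulr1 => <-.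
apply: eq_integral => w _; rewrite big_geq// cos0 mulr1 /Y big_mkord.
by under [in RHS]eq_bigr do rewrite ZE.
Qed.

End LaplaceTransformOfSquaredNorm.

(** The numerical fact behind the exponent d/16. *)
Lemma expR_5_16_le (R : realType) : expR (5 / 16) <= Num.sqrt 2 :> R.
Proof.
rewrite -(@ler_pXn2r _ 2) ?nnegrE ?expR_ge0 ?sqrtr_ge0// sqr_sqrtr// -expRM_natl.
(* (59/64)^8 >= 1/2 bounds exp(-5/8) from below. *)
have h : 59 / 64 <= expR (- (5 / 64)) :> R.
  by apply: le_trans (expR_ge1Dx _); lra.
have h8 : (59 / 64) ^+ 8 <= expR (- (5 / 64)) ^+ 8 :> R.
  by rewrite ler_pXn2r ?nnegrE ?expR_ge0//; lra.
rewrite -expRM_natl in h8.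
have e8 : 8 * - (5 / 64) = - (2 * (5 / 16)) :> R by field.
rewrite e8 expRN in h8.
have pos := expR_gt0 (2 * (5 / 16) : R).
rewrite -[leLHS]invrK -[leRHS]invrK lef_pV2 ?posrE ?invr_gt0//.
by apply: le_trans h8; lra.
Qed.

Section GaussianLowerTail.
Context {R : realType} {dT : measure_display} {T : measurableType dT}.
Variable P : probability T R.

Lemma measurable_sublevel (f : T -> R) (t : R) : measurable_fun setT f ->
  measurable [set w | f w < t].
Proof.
move=> mf; rewrite (_ : [set w | _] = setT `&` f @^-1` `]-oo, t[); first exact: mf.
by apply/seteqP; split=> w; rewrite /= in_itv/= => // -[].
Qed.

(** A vector with characteristic function exp(-v |a|^2 / 2) has squared norm
    below half its mean v d with probability at most exp(-d/16). *)
Lemma gaussian_sqnorm_lower_tail (d : nat) (v : R) (X : 'I_d -> T -> R) : 0 < v ->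
  (forall i, measurable_fun setT (X i)) ->
  (forall a : 'I_d -> R, \int[P]_w (cos (\sum_i a i * X i w))%:E =
     (expR (- (v * (\sum_i a i ^+ 2) / 2)))%:E)%E ->
  (P [set w | (\sum_i X i w ^+ 2 < v * d%:R / 2)%R] <= (expR (- (d%:R / 16)))%:E)%E.
Proof.
move=> v0 mX hX; pose Y i w := (Num.sqrt v)^-1 * X i w.
have sv0 : 0 < Num.sqrt v by rewrite sqrtr_gt0.
have mY i : measurable_fun setT (Y i) by exact: measurable_funM.
have Y2 w : \sum_i Y i w ^+ 2 = v^-1 * \sum_i X i w ^+ 2.
  rewrite mulr_sumr; apply: eq_bigr => i _.
  by rewrite /Y exprMn exprVn sqr_sqrtr// ltW.
have hY := gaussian_laplace_sqnorm mY.
pose f w := expR (- ((\sum_i Y i w ^+ 2) / 2)).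
have mf : measurable_fun setT f.
  apply: measurableT_comp => //; apply: measurableT_comp => //.
  by apply: measurable_funM => //; apply: measurable_sum => i; exact: measurable_funX.
set A := [set w | _].
have mA : measurable A.
  apply: measurable_sublevel; apply: measurable_sum => i; exact: measurable_funX.
have fint : (\int[P]_w (f w)%:E = ((Num.sqrt 2 ^+ d)^-1 : R)%:E)%E.
  apply: hY => a.
  have := hX (fun i => (Num.sqrt v)^-1 * a i).
  have -> : v * (\sum_i ((Num.sqrt v)^-1 * a i) ^+ 2) = \sum_i a i ^+ 2.
    rewrite mulr_sumr; apply: eq_bigr => i _.
    by rewrite exprMn exprVn sqr_sqrtr ?ltW// mulrA divff ?mul1r// gt_eqF.
  move=> <-; apply: eq_integral => w _; congr (EFin (cos _)).
  by apply: eq_bigr => i _; rewrite /Y mulrCA mulrA.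
have step : (P A * (expR (- (d%:R / 4)))%:E <= ((Num.sqrt 2 ^+ d)^-1 : R)%:E)%E.
  rewrite -fint muleC -integral_cst//.
  apply: (@le_trans _ _ (\int[P]_(w in A) (f w)%:E)%E).
    apply: ge0_le_integral => //.
    - by move=> w _; rewrite lee_fin expR_ge0.
    - by apply: measurable_funTS; exact/measurable_EFinP.
    - move=> w; rewrite /A/= => Aw; rewrite lee_fin ler_expR Y2.
      have : v^-1 * (\sum_i X i w ^+ 2) < d%:R / 2.
        by rewrite mulrC ltr_pdivrMr// mulrAC (mulrC _ v).
      lra.
  apply: ge0_subset_integral => //; first exact/measurable_EFinP.
  by move=> w _; rewrite lee_fin expR_ge0.
rewrite -(@fineK _ (P A)) ?fin_num_measure// in step *.
move: step; rewrite -EFinM !lee_fin -ler_pdivlMr ?expR_gt0// => step.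
apply: le_trans step _; rewrite -expRN opprK -exprVn.
have -> : expR (d%:R / 4) = expR (1 / 4) ^+ d :> R by rewrite -expRM_natl mulrA mulr1.
have -> : expR (- (d%:R / 16)) = expR (- (1 / 16)) ^+ d :> R.
  by rewrite -expRM_natl mulrN mulrA mulr1.
rewrite -exprMn lerXn2r ?nnegrE ?mulr_ge0 ?invr_ge0 ?sqrtr_ge0 ?expR_ge0//.
rewrite mulrC ler_pdivrMr ?sqrtr_gt0//.
have -> : 1 / 4 = - (1 / 16) + 5 / 16 :> R by field.
by rewrite expRD ler_pM2l ?expR_gt0// expR_5_16_le.
Qed.

End GaussianLowerTail.

(** * Expectations determined by laws and independence *)

Section ExpectationsFromLaws.
Context {R : realType} {dT : measure_display} {T : measurableType dT}.
Variable P : probability T R.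
Implicit Types U V : T -> R.

Lemma integral_same_law U V (f : R -> R) (M : R) :
  measurable_fun setT U -> measurable_fun setT V -> measurable_fun setT f ->
  (forall x, `|f x| <= M) ->
  (forall A, measurable A -> P (U @^-1` A) = P (V @^-1` A)) ->
  (\int[P]_w (f (U w))%:E = \int[P]_w (f (V w))%:E)%E.
Proof.
move=> mU mV mf fM UV.
pose U' : {mfun T >-> R} := HB.pack U (isMeasurableFun.Build _ _ _ _ U mU).
pose V' : {mfun T >-> R} := HB.pack V (isMeasurableFun.Build _ _ _ _ V mV).
have int W : measurable_fun setT W -> P.-integrable setT ((EFin \o f) \o W).
  move=> mW; apply: (@bounded_integrable _ _ _ _ (f \o W) M) => [|w]; last exact: fM.
  exact: measurableT_comp.
have mf' : measurable_fun setT (EFin \o f) by exact/measurable_EFinP.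
transitivity (\int[distribution P U']_x (f x)%:E)%E.
  by rewrite (integral_pushforward mU mf' (int _ mU)).
rewrite (eq_measure_integral (distribution P V')).
  by rewrite (integral_pushforward mV mf' (int _ mV)).
by move=> A mA _; exact: UV.
Qed.

Lemma integral_cos_centered_normal U (v : R) : 0 <= v -> measurable_fun setT U ->
  (forall A, measurable A -> P (U @^-1` A) = centered_normal v A) ->
  (\int[P]_w (cos (U w))%:E = (expR (- (v / 2)))%:E)%E.
Proof.
move=> v0 mU UE.
pose U' : {mfun T >-> R} := HB.pack U (isMeasurableFun.Build _ _ _ _ U mU).
have mf' : measurable_fun setT (EFin \o @cos R).
  by apply/measurable_EFinP; exact: measurable_cos.
have int : P.-integrable setT ((EFin \o @cos R) \o U).
  apply: (@bounded_integrable _ _ _ _ (@cos R \o U) 1).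
    by apply: measurableT_comp => //; exact: measurable_cos.
  by move=> w; exact: cos_max.
move: UE; rewrite /centered_normal; case: eqP => [->|/eqP v1] UE.
  transitivity (\int[distribution P U']_x (cos x)%:E)%E.
    by rewrite (integral_pushforward mU mf' int).
  rewrite (eq_measure_integral (\d_(0 : R))); last by move=> A mA _; exact: UE.
  by rewrite integral_dirac// diracE mem_set// mul1e cos0 mul0r oppr0 expR0.
(* The same map, towards the copy of R on which the normal law is defined. *)
have mU2 : measurable_fun setT (U : T -> measurableTypeR R) by exact: mU.
pose U2 : {mfun T >-> measurableTypeR R} :=
  HB.pack (U : T -> measurableTypeR R)
    (isMeasurableFun.Build _ _ T (measurableTypeR R) U mU2).
have mf2 : measurable_fun [set: measurableTypeR R] (EFin \o @cos R) by exact: mf'.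
transitivity (\int[distribution P U2]_x (cos x)%:E)%E.
  by rewrite (integral_pushforward mU2 mf2 int).
rewrite (eq_measure_integral (normal_prob 0 (Num.sqrt v))); last first.
  by move=> A mA _; exact: UE.
have sv0 : 0 < Num.sqrt v by rewrite sqrtr_gt0 lt_def v1.
transitivity (\int[normal_prob 0 (Num.sqrt v)]_x (cos (1 * x))%:E)%E.
  by apply: eq_integral => x _; rewrite mul1r.
by rewrite integral_cos_normal_prob// sqr_sqrtr// expr1n mulr1.
Qed.

(** Independence gives a product law for (U, V), hence Fubini's theorem splits
    the integral. *)
Lemma integral_independent_product U V (f g : R -> R) :
  measurable_fun setT U -> measurable_fun setT V ->
  measurable_fun setT f -> measurable_fun setT g ->
  (forall x, `|f x| <= 1) -> (forall x, `|g x| <= 1) ->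
  (forall A B, measurable A -> measurable B ->
    P ((U @^-1` A) `&` (V @^-1` B)) = (P (U @^-1` A) * P (V @^-1` B))%E) ->
  (\int[P]_w (f (U w) * g (V w))%:E =
    (\int[P]_w (f (U w))%:E) * (\int[P]_w (g (V w))%:E))%E.
Proof.
move=> mU mV mf mg f1 g1 ind.
pose UV w := (U w, V w).
have mUV : measurable_fun setT UV by exact: measurable_fun_pair.
pose U' : {mfun T >-> R} := HB.pack U (isMeasurableFun.Build _ _ _ _ U mU).
pose V' : {mfun T >-> R} := HB.pack V (isMeasurableFun.Build _ _ _ _ V mV).
pose W' : {mfun T >-> (R * R)%type} := HB.pack UV (isMeasurableFun.Build _ _ _ _ UV mUV).
pose m1 : probability R R := distribution P U'.
pose m2 : probability R R := distribution P V'.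
pose h (z : R * R) : R := f z.1 * g z.2.
have mh : measurable_fun setT h by apply: measurable_funM; exact: measurableT_comp.
have h1 z : `|h z| <= 1 by rewrite normrM -[1]mulr1 ler_pM.
have int : P.-integrable setT ((EFin \o h) \o UV).
  apply: (@bounded_integrable _ _ _ _ (h \o UV) 1) => [|w]; last exact: h1.
  exact: measurableT_comp.
have mh' : measurable_fun setT (EFin \o h) by exact/measurable_EFinP.
transitivity (\int[distribution P W']_z (h z)%:E)%E.
  by rewrite (integral_pushforward mUV mh' int).
rewrite (eq_measure_integral (m1 \x m2)%E); last first.
  move=> A mA _; apply/esym; apply: (@product_measure_unique _ _ _ _ _ m1 m2) => //.
have inth : (m1 \x m2)%E.-integrable setT (EFin \o h).
  apply: measurable_bounded_integrable => //.
    rewrite -setXTT [ltLHS]product_measure1E//.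
    by rewrite [X in (X * _)%E]probability_setT [X in (_ * X)%E]probability_setT mule1 ltry.
  by exists 1; split; [exact: num_real|move=> x x1 z _; exact: le_trans (ltW x1)].
rewrite -(integral12_prod_meas1 inth).
have intf : m1.-integrable setT (EFin \o f) by exact: bounded_integrable f1.
have intg : m2.-integrable setT (EFin \o g) by exact: bounded_integrable g1.
have Ef : (\int[P]_w (f (U w))%:E = \int[m1]_x (f x)%:E)%E.
  rewrite (integral_pushforward mU)//; first exact/measurable_EFinP.
  apply: (@bounded_integrable _ _ _ _ (f \o U) 1) => [|w]; last exact: f1.
  exact: measurableT_comp.
have Eg : (\int[P]_w (g (V w))%:E = \int[m2]_x (g x)%:E)%E.
  rewrite (integral_pushforward mV)//; first exact/measurable_EFinP.
  apply: (@bounded_integrable _ _ _ _ (g \o V) 1) => [|w]; last exact: g1.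
  exact: measurableT_comp.
rewrite Ef Eg -(@fineK _ (\int[m2]_x (g x)%:E)); last exact: integrable_fin_num.
rewrite -integralZr//; apply: eq_integral => x _.
rewrite /fubini_F/= /h/=; under eq_integral do rewrite EFinM.
rewrite integralZl//; congr (_ * _)%E.
by rewrite fineK//; exact: integrable_fin_num.
Qed.

(** For independent centered normals the sine product of
    cos(u - v) = cos u cos v + sin u sin v averages to zero by symmetry. *)
Lemma integral_cos_sub_independent U V (u v : R) :
  0 <= u -> 0 <= v -> measurable_fun setT U -> measurable_fun setT V ->
  (forall A, measurable A -> P (U @^-1` A) = centered_normal u A) ->
  (forall A, measurable A -> P ((fun w => - U w) @^-1` A) = centered_normal u A) ->
  (forall A, measurable A -> P (V @^-1` A) = centered_normal v A) ->
  (forall A B, measurable A -> measurable B ->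
    P ((U @^-1` A) `&` (V @^-1` B)) = (P (U @^-1` A) * P (V @^-1` B))%E) ->
  (\int[P]_w (cos (U w - V w))%:E = (expR (- ((u + v) / 2)))%:E)%E.
Proof.
move=> u0 v0 mU mV lU lNU lV ind.
have mNU : measurable_fun setT (fun w => - U w) by exact: measurableT_comp.
have intcos W : measurable_fun setT W ->
    P.-integrable setT (EFin \o (fun w => cos (W w) : R)).
  move=> mW; apply: (@bounded_integrable _ _ _ _ _ 1) => [|w]; last exact: cos_max.
  by apply: measurableT_comp => //; exact: measurable_cos.
have intsin W : measurable_fun setT W ->
    P.-integrable setT (EFin \o (fun w => sin (W w) : R)).
  move=> mW; apply: (@bounded_integrable _ _ _ _ _ 1) => [|w]; last exact: sin_max.
  by apply: measurableT_comp => //; exact: measurable_sin.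
have Esin : (\int[P]_w (sin (U w))%:E = 0)%E.
  have : (\int[P]_w (sin (U w))%:E = \int[P]_w (sin (- U w))%:E)%E.
    apply: (@integral_same_law U (fun w => - U w) (@sin R) 1) => //.
    - exact: measurable_sin.
    - exact: sin_max.
    - by move=> A mA; rewrite lU// lNU.
  under [X in _ = X]eq_integral do rewrite sinN EFinN.
  rewrite integralN//; last exact: integrable_add_def (intsin _ mU).
  rewrite -(@fineK _ (\int[P]_w _)%E); last exact: integrable_fin_num (intsin _ mU).
  by rewrite -EFinN => -[e]; congr EFin; lra.
have -> : (\int[P]_w (cos (U w - V w))%:E =
   \int[P]_w (cos (U w) * cos (V w))%:E + \int[P]_w (sin (U w) * sin (V w))%:E)%E.
  rewrite -integralD//; last 2 first.
  - apply: (@bounded_integrable _ _ _ _ _ 1) => [|w].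
      by apply: measurable_funM; apply: measurableT_comp => //; exact: measurable_cos.
    by rewrite normrM -[1]mulr1 ler_pM ?cos_max.
  - apply: (@bounded_integrable _ _ _ _ _ 1) => [|w].
      by apply: measurable_funM; apply: measurableT_comp => //; exact: measurable_sin.
    by rewrite normrM -[1]mulr1 ler_pM ?sin_max.
  by apply: eq_integral => w _; rewrite -EFinD cosB.
rewrite (@integral_independent_product U V (@cos R) (@cos R))//; last 4 first.
- exact: measurable_cos.
- exact: measurable_cos.
- exact: cos_max.
- exact: cos_max.
rewrite (@integral_independent_product U V (@sin R) (@sin R))//; last 4 first.
- exact: measurable_sin.
- exact: measurable_sin.
- exact: sin_max.
- exact: sin_max.
rewrite Esin mul0e adde0 (integral_cos_centered_normal u0 mU lU).
rewrite (integral_cos_centered_normal v0 mV lV) -EFinM -expRD.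
by congr (EFin (expR _)); field.
Qed.

End ExpectationsFromLaws.

(** * Feature distances in the correlated model *)

Section LinearForms.
Context {R : realType} {dT : measure_display} {T : measurableType dT} {m : nat}.
Implicit Types (X : T -> 'rV[R]_m) (b : 'cV[R]_m).

Lemma measurable_linear_form X b : (forall k, measurable_fun setT (fun w => X w 0 k)) ->
  measurable_fun setT (fun w => (X w *m b) 0 0).
Proof.
move=> mX; rewrite (_ : (fun w => _) = (fun w => \sum_k X w 0 k * b k 0)).
  by apply: measurable_sum => k; exact: measurable_funM.
by apply/funext => w; rewrite mxE.
Qed.

Lemma sigma_vec_linear_form X b (A : set R) : measurable A ->
  sigma_vec X ((fun w => (X w *m b) 0 0) @^-1` A).
Proof.
move=> mA; pose S := g_sigma_algebraType
  (\big[setU/set0]_(k < m) preimage_set_system setT (fun w => X w 0 k) measurable).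
have mX k : measurable_fun setT (fun w : S => X w 0 k).
  move=> _ B mB; rewrite setTI; apply: sub_sigma_algebra.
  by rewrite (bigD1 k)//=; left; exists B => //; rewrite setTI.
have : measurable_fun setT (fun w : S => (X w *m b) 0 0).
  rewrite (_ : (fun w => _) = (fun w : S => \sum_k X w 0 k * b k 0)); last first.
    by apply/funext => w; rewrite mxE.
  by apply: measurable_sum => k; exact: measurable_funM.
by move=> /(_ measurableT A mA); rewrite setTI.
Qed.

End LinearForms.

Lemma mutually_independent_pair {R : realType} {dT : measure_display}
  {T : measurableType dT} (P : probability T R) (I : finType)
  (F : I -> set (set T)) (i j : I) (A B : set T) :
  mutually_independent P F -> i != j -> F i A -> F j B ->
  P (A `&` B) = (P A * P B)%E.
Proof.
move=> ind ij FA FB.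
pose E k := if k == i then A else B.
have Ei : E i = A by rewrite /E eqxx.
have Ej : E j = B by rewrite /E eq_sym (negbTE ij).
have := ind [set i; j]%SET E.
rewrite big_setU1 ?inE// big_set1 Ei Ej => <-.
- congr (P _); apply/seteqP; split=> w.
  + by move=> [Aw Bw] k /=; rewrite !inE => /orP[]/eqP ->; rewrite ?Ei ?Ej.
  + move=> h; split; first by rewrite -Ei; apply: h; rewrite /= !inE eqxx.
    by rewrite -Ej; apply: h; rewrite /= !inE eqxx orbT.
- by move=> k; rewrite !inE => /orP[]/eqP ->; rewrite ?Ei ?Ej.
Qed.

(** Variance of the projection of a pair with covariance [corr_cov d r] on the
    direction (a, b). *)
Lemma corr_cov_quad (R : realType) (d : nat) (r : R) (a b : 'cV[R]_d) :
  ((col_mx a b)^T *m corr_cov d r *m col_mx a b) 0 0 =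
  \sum_i a i 0 ^+ 2 + \sum_i b i 0 ^+ 2 + 2 * r * \sum_i a i 0 * b i 0.
Proof.
have dot (x y : 'cV[R]_d) : (x^T *m y) 0 0 = \sum_i x i 0 * y i 0.
  by rewrite mxE; apply: eq_bigr => i _; rewrite mxE.
rewrite tr_col_mx mul_row_block mul_row_col !mulmx1 !mul_mx_scalar.
have D (X Y : 'M[R]_1) : (X + Y) 0 0 = X 0 0 + Y 0 0 by rewrite mxE.
have Z (c : R) (X : 'M[R]_1) : (c *: X) 0 0 = c * X 0 0 by rewrite mxE.
rewrite !mulmxDl -!scalemxAl !D !Z !dot.
have -> : \sum_i b i 0 * a i 0 = \sum_i a i 0 * b i 0.
  by apply: eq_bigr => i _; rewrite mulrC.
under [X in _ = X + _ + _]eq_bigr do rewrite expr2.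
under [X in _ = _ + X + _]eq_bigr do rewrite expr2.
by ring.
Qed.

Section FeatureDifferences.
Context {R : realType} {dT : measure_display} {T : measurableType dT}.
Variables (P : probability T R) (n d : nat) (rho r : R) (s : 'S_n).
Variables (G1 G2 : T -> featured_graph R n d).
Hypothesis model : featured_wigner P rho r s G1 G2.
Hypothesis r01 : 0 < r < 1.

Let Xf := feature_pair s G1 G2.

Let gaussian_Xf i : gaussian_vector P (corr_cov d r) (Xf i).
Proof. by case: model. Qed.

Let law_Xf i (a b : 'cV[R]_d) (A : set R) : measurable A ->
  P ((fun w => (Xf i w *m col_mx a b) 0 0) @^-1` A) =
  centered_normal (\sum_k a k 0 ^+ 2 + \sum_k b k 0 ^+ 2 +
    2 * r * \sum_k a k 0 * b k 0) A.
Proof.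
by move=> mA; have [_ /(_ (col_mx a b) A mA) ->] := gaussian_Xf i; rewrite corr_cov_quad.
Qed.

Let measurable_Xf i (b : 'cV[R]_(d + d)) :
  measurable_fun setT (fun w => (Xf i w *m b) 0 0).
Proof. by apply: measurable_linear_form; case: (gaussian_Xf i). Qed.

Let Xf_col i w (a b : 'cV[R]_d) : (Xf i w *m col_mx a b) 0 0 =
  \sum_c feat (G1 w) i c * a c 0 + \sum_c feat (G2 w) (s i) c * b c 0.
Proof.
rewrite /Xf /feature_pair mul_row_col mxE; congr (_ + _); rewrite mxE;
  by apply: eq_bigr => c _; rewrite mxE.
Qed.

Lemma measurable_feat1 k c : measurable_fun setT (fun w => feat (G1 w) k c).
Proof.
have := measurable_Xf k (col_mx (delta_mx c 0) 0).
congr measurable_fun; apply/funext => w; rewrite Xf_col (bigD1 c)//= big1.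
  by rewrite big1 => [|i _]; rewrite !mxE ?mulr0// !eqxx mulr1 !addr0.
by move=> i ic; rewrite mxE (negbTE ic) mulr0.
Qed.

Lemma measurable_feat2 l c : measurable_fun setT (fun w => feat (G2 w) l c).
Proof.
have := measurable_Xf (s^-1%g l) (col_mx 0 (delta_mx c 0)).
congr measurable_fun; apply/funext => w; rewrite Xf_col permKV addrC (bigD1 c)//= big1.
  by rewrite big1 => [|i _]; rewrite !mxE ?mulr0// !eqxx mulr1 !addr0.
by move=> i ic; rewrite mxE (negbTE ic) mulr0.
Qed.

(** Coordinate variance of x_k - y_l: 2 (1 - r) for a matched pair, and 2 for
    an unmatched one, whose two vectors are independent. *)
Definition feat_diff_var (k l : 'I_n) : R := if l == s k then 2 * (1 - r) else 2.

(** Characteristic function of x_k - y_l. *)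
Lemma integral_cos_feat_diff k l (a : 'I_d -> R) :
  (\int[P]_w (cos (\sum_c a c * (feat (G1 w) k c - feat (G2 w) l c)))%:E =
   (expR (- (feat_diff_var k l * (\sum_c a c ^+ 2) / 2)))%:E)%E.
Proof.
pose A : 'cV[R]_d := \col_c a c.
have A2 : \sum_c A c 0 ^+ 2 = \sum_c a c ^+ 2 by apply: eq_bigr => c _; rewrite mxE.
have NA2 : \sum_c (- A) c 0 ^+ 2 = \sum_c a c ^+ 2.
  by apply: eq_bigr => c _; rewrite !mxE sqrrN.
have Z2 : \sum_c (0 : 'cV[R]_d) c 0 ^+ 2 = 0.
  by apply: big1 => c _; rewrite mxE expr0n.
have zl (B : 'cV[R]_d) : \sum_c B c 0 * (0 : 'cV[R]_d) c 0 = 0.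
  by apply: big1 => c _; rewrite mxE mulr0.
have zr (B : 'cV[R]_d) : \sum_c (0 : 'cV[R]_d) c 0 * B c 0 = 0.
  by apply: big1 => c _; rewrite mxE mul0r.
have Q0 : 0 <= \sum_c a c ^+ 2 by apply: sumr_ge0 => c _; exact: sqr_ge0.
set Q := \sum_c a c ^+ 2 in A2 NA2 Q0 *.
(* y_l belongs to the feature pair of index k'. *)
pose k' := s^-1%g l.
have diffE w : \sum_c a c * (feat (G1 w) k c - feat (G2 w) l c) =
   \sum_c feat (G1 w) k c * A c 0 - \sum_c feat (G2 w) (s k') c * A c 0.
  rewrite -sumrB; apply: eq_bigr => c _.
  by rewrite /k' permKV mxE; ring.
under eq_integral do rewrite diffE.
rewrite /feat_diff_var; case: eqP => [lk|/eqP lk].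
- have kk : k' = k by rewrite /k' lk permK.
  have e w : \sum_c feat (G1 w) k c * A c 0 - \sum_c feat (G2 w) (s k') c * A c 0 =
      (Xf k w *m col_mx A (- A)) 0 0.
    rewrite Xf_col kk; congr (_ + _); rewrite -sumrN.
    by apply: eq_bigr => c _; rewrite [(- A) _ _]mxE mulrN.
  under eq_integral do rewrite e.
  rewrite (@integral_cos_centered_normal _ _ _ P _ (2 * (1 - r) * Q)) //.
    by rewrite !mulr_ge0// subr_ge0; case/andP: r01 => _ /ltW.
  have AA : \sum_c A c 0 * (- A) c 0 = - Q.
    by rewrite -A2 -sumrN; apply: eq_bigr => c _; rewrite !mxE; ring.
  move=> B mB; rewrite (law_Xf k A (- A) mB) A2 NA2 AA.
  have -> : Q + Q + 2 * r * - Q = 2 * (1 - r) * Q by ring.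
  by [].
- have kk : k != k' by apply: contraNneq lk => ->; rewrite /k' permKV.
  have e w : \sum_c feat (G1 w) k c * A c 0 - \sum_c feat (G2 w) (s k') c * A c 0 =
      (Xf k w *m col_mx A 0) 0 0 - (Xf k' w *m col_mx 0 A) 0 0.
    have z (F : 'I_d -> R) : \sum_c F c * (0 : 'cV[R]_d) c 0 = 0.
      by apply: big1 => c _; rewrite mxE mulr0.
    by rewrite !Xf_col !z addr0 add0r.
  under eq_integral do rewrite e.
  rewrite (@integral_cos_sub_independent _ _ _ P _ _ Q Q) //.
  + by congr (expR (- _))%:E; field.
  + by move=> B mB; rewrite (law_Xf k A 0 mB) A2 Z2 zl mulr0 !addr0.
  + move=> B mB.
    rewrite (_ : (fun w => - _) = (fun w => (Xf k w *m col_mx (- A) 0) 0 0)).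
      by rewrite (law_Xf k (- A) 0 mB) NA2 Z2 zl mulr0 !addr0.
    apply/funext => w; have -> : col_mx (- A) 0 = - col_mx A (0 : 'cV[R]_d).
      by rewrite opp_col_mx oppr0.
    by rewrite mulmxN [RHS]mxE.
  + by move=> B mB; rewrite (law_Xf k' 0 A mB) A2 Z2 zr mulr0 add0r addr0.
  + move=> B C mB mC; case: model => _ _ _ ind _.
    by apply: (mutually_independent_pair ind kk); exact: sigma_vec_linear_form.
Qed.

(** A pair of features is at squared distance less than (1 - r) d with
    probability at most exp(-d/16). *)
Lemma feat_diff_lower_tail k l :
  (P [set w | (\sum_c (feat (G1 w) k c - feat (G2 w) l c) ^+ 2 < (1 - r) * d%:R)%R]
    <= (expR (- (d%:R / 16)))%:E)%E.
Proof.
have r1 : 0 < 1 - r by rewrite subr_gt0; case/andP: r01.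
have r0 : 0 < r by case/andP: r01.
have v0 : 0 < feat_diff_var k l by rewrite /feat_diff_var; case: ifP => _; lra.
have mX c : measurable_fun setT (fun w => feat (G1 w) k c - feat (G2 w) l c).
  by apply: measurable_funB; [exact: measurable_feat1|exact: measurable_feat2].
apply: le_trans (gaussian_sqnorm_lower_tail v0 mX (integral_cos_feat_diff k l)).
have mS t : measurable [set w | \sum_c (feat (G1 w) k c - feat (G2 w) l c) ^+ 2 < t].
  by apply: measurable_sublevel; apply: measurable_sum => c; exact: measurable_funX.
apply: le_measure; rewrite ?inE//.
move=> w /= h; apply: lt_le_trans h _.
rewrite mulrAC ler_wpM2r// /feat_diff_var; case: ifP => _; lra.
Qed.

End FeatureDifferences.

(** * Convergence with high probability *)

Lemma probability_bigsetU_le {R : realType} {dT : measure_display}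
  {T : measurableType dT} (P : probability T R) (I : Type) (B : I -> set T)
  (c : R) (s : seq I) :
  (forall i, measurable (B i)) -> (forall i, (P (B i) <= c%:E)%E) ->
  (P (\big[setU/set0]_(i <- s) B i) <= ((size s)%:R * c)%:E)%E.
Proof.
move=> mB Bc; elim: s => [|i s IH].
  by rewrite big_nil measure0 mul0r.
rewrite big_cons (le_trans (measureU2 _ _ _))//.
  exact: bigsetU_measurable.
by rewrite /= -natr1 mulrDl mul1r EFinD [leRHS]addeC; exact: leeD (Bc i) IH.
Qed.

(** The sample size beyond which the union bound over the n^2 pairs of
    features costs at most delta. *)
Lemma union_bound_le (R : realType) (n d : nat) (delta : R) : (0 < n)%N ->
  0 < delta -> 32 * ln (n%:R / Num.sqrt delta) < d%:R ->
  (n * n)%:R * expR (- (d%:R / 16)) <= delta.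
Proof.
move=> n0 delta0 hd; have n0' : 0 < n%:R :> R by rewrite ltr0n.
have sd0 : 0 < Num.sqrt delta by rewrite sqrtr_gt0.
have q0 : 0 < n%:R / Num.sqrt delta by rewrite divr_gt0.
apply: (@le_trans _ _ ((n * n)%:R * expR (- (2 * ln (n%:R / Num.sqrt delta))))).
  by rewrite ler_wpM2l// ler_expR; lra.
rewrite expRN expRM_natl lnK ?posrE// expr_div_n (sqr_sqrtr (ltW delta0)) invf_div.
by rewrite natrM -expr2 mulrCA divff ?mulr1// expf_neq0// gt_eqF.
Qed.

Theorem proposition5 (R : realType) (n d : nat) :
  exists L : featured_graph R n d -> featured_graph R n d -> R,
    (forall g1 g2, 0 < L g1 g2) /\
    forall (rho r : R), 0 < rho < 1 -> 0 < r < 1 ->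
    forall (s : 'S_n) (dT : measure_display) (T : measurableType dT)
      (P : probability T R) (G1 G2 : T -> featured_graph R n d),
      featured_wigner P rho r s G1 G2 ->
    forall delta : R, 0 < delta < 1 ->
      32 * ln (n%:R / Num.sqrt delta) < d%:R ->
    exists E : set T,
      [/\ measurable E,
          ((1 - delta)%:E <= P E)%E &
          forall w, E w ->
          forall eta : R, 0 < eta <= (L (G1 w) (G2 w))^-1 ->
          forall M' M0 : 'M[R]_n,
            argmin (objective rho r (G1 w) (G2 w)) (birkhoff (n := n)) M' ->
            birkhoff M0 ->
          forall K : nat, (1 <= K)%N ->
            frob (pgd (objective rho r (G1 w) (G2 w)) eta M0 K - M') <=
            Num.sqrt (n%:R / ((1 - lam rho r) * (1 - r) * d%:R * eta * K%:R))].
Proof.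
exists (@smoothness R n d); split; first by move=> g1 g2; exact: smoothness_gt0.
move=> rho r rho01 r01 s dT T P G1 G2 model delta /andP[delta0 delta1] hd.
pose B (p : 'I_n * 'I_n) := [set w |
  \sum_c (feat (G1 w) p.1 c - feat (G2 w) p.2 c) ^+ 2 < (1 - r) * d%:R].
have mB p : measurable (B p).
  apply: measurable_sublevel; apply: measurable_sum => c; apply: measurable_funX.
  apply: measurable_funB; first exact: measurable_feat1 model _ _.
  exact: measurable_feat2 model _ _.
have PB p := feat_diff_lower_tail model r01 p.1 p.2.
pose bad := \big[setU/set0]_(p <- enum {: 'I_n * 'I_n}) B p.
have mbad : measurable bad by exact: bigsetU_measurable.
have Pbad : (P bad <= delta%:E)%E.
  apply: le_trans (probability_bigsetU_le _ mB PB) _.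
  rewrite -cardE card_prod card_ord lee_fin.
  have [->|n0] := posnP n; first by rewrite mul0r ltW.
  exact: union_bound_le.
exists (~` bad); split.
- exact: measurableC.
- by rewrite probability_setC// EFinB leeB.
move=> w good eta eta01 M' M0 argM' BM0 K K1.
apply: frob_pgd_le => //.
- (* d = 0 would force n <= sqrt delta < 1. *)
  move=> n0; rewrite -(ltr0n R); apply: le_lt_trans hd.
  rewrite mulr_ge0// ln_ge0// ler_pdivlMr ?sqrtr_gt0// mul1r.
  apply: (@le_trans _ _ 1); last by rewrite ler1n.
  by rewrite -sqrtr1 ler_wsqrtr// ltW.
- move=> k l; rewrite leNgt; apply/negP => Bkl; apply: good.
  by rewrite /bad (bigD1_seq (k, l)) ?mem_enum ?enum_uniq//=; left.
Qed.
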